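(* Let $T_1,\dots,T_d$ be commuting, measure-preserving, bijective maps on a probability space $(\Omega,\mathcal F,\mathbb P)$, let $T^j:=T_1^{j_1}\circ\cdots\circ T_d^{j_d}$ for $j=(j_1,\dots,j_d)\in\mathbb Z^d$, and let $\mathcal I:=\{A\in\mathcal F: T_k^{-1}A=A\text{ for all }1\le k\le d\}$. Fix $\kappa\in[1,+\infty]$ and let $|\cdot|$ be the $\ell^\kappa$-norm on $\mathbb R^d$. Let $\psi:\mathbb R^d\to\mathbb R$ be a function such that (i) $|\psi(x)|\le\vartheta(|x|)$ for all $x\in\mathbb R^d$, for some $d$-good function $\vartheta$; (ii) $\lim_{n\to+\infty}\frac1{n^d}\sum_{j\in\mathbb Z^d}|\psi(j/n)-\psi((j+e_i)/n)|=0$ for every $i=1,\dots,d$, where $e_1,\dots,e_d$ is the canonical basis of $\mathbb Z^d$; (iii) the limit $c(\psi):=\lim_{n\to+\infty}\frac1{n^d}\sum_{j\in\mathbb Z^d}\psi(j/n)$ exists and is finite. Then, for every $p\in[1,+\infty)$ and every measurable $f:\Omega\to\mathbb R$ in $L^p(\Omega,\mathcal F,\mathbb P)$, $$\lim_{n\to+\infty}\frac1{n^d}\sum_{j\in\mathbb Z^d}\psi(j/n)\,f(T^j\omega)=c(\psi)\,\mathbb E[f\,|\,\mathcal I]$$ both $\mathbb P$-a.s. and in $L^p$.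
   Context: $\mathbb R_+=[0,+\infty)$; $\mathbb N=\{0,1,2,\dots\}$. The maps $T_i$ and their inverses are measurable and preserve $\mathbb P$, so that $(T^j)_{j\in\mathbb Z^d}$ is a measure-preserving action of $\mathbb Z^d$. $\mathbb E$ is expectation with respect to $\mathbb P$. Definition. A function $\vartheta:\mathbb R_+\to\mathbb R_+$ is called $d$-good if it is non-increasing and $\sum_{m=0}^\infty m^{2d}\vartheta(m)\rho(m)^{-1}<+\infty$ for some positive summable function $\rho:\mathbb N\to(0,+\infty)$. Under (i) the series in (iii) is absolutely convergent, and the series $\sum_j\psi(j/n)f(T^j\omega)$ is absolutely convergent for $\mathbb P$-a.a. $\omega$. *)

(* Defs.v *)
From HB Require Import structures.
From mathcomp Require Import all_boot all_order all_algebra.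
From mathcomp Require Import all_classical all_reals all_analysis.
From mathcomp Require Import measurable_realfun.
Import Order.TTheory GRing.Theory Num.Theory.
Import numFieldNormedType.Exports.

Set Implicit Arguments.
Unset Strict Implicit.
Unset Printing Implicit Defensive.

Local Open Scope classical_set_scope.
Local Open Scope ring_scope.

(* Sum of a real family over an arbitrary index set, as an element of \bar R.
   It is finite exactly when the family is absolutely summable: if one or both
   of the two nonnegative sums are infinite, the difference is -oo or +oo
   (recall that +oo - +oo = -oo in \bar R). *)
Definition fsum (R : realType) (I : choiceType) (a : I -> R) : \bar R :=
  (\esum_(i in [set: I]) (fun k => (a k)%:E)^\+ i
   - \esum_(i in [set: I]) (fun k => (a k)%:E)^\- i)%E.

(* The lattice point j / n; only n >= 1 is meaningful. *)
Definition scaled (R : realType) (d : nat) (n : nat) (j : 'rV[int]_d)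
  : 'rV[R]_d := n%:R^-1 *: map_mx intr j.

(* n ^ -d * \sum_(j in Z^d) a j *)
Definition normalized_sum (R : realType) (d : nat) (n : nat)
  (a : 'rV[int]_d -> R) : \bar R := ((n%:R ^+ d)^-1%:E * fsum a)%E.

Definition ellnorm (R : realType) (d : nat) (kappa : \bar R) (x : 'rV[R]_d)
  : R :=
  match kappa with
  | r%:E%E => (\sum_(i < d) `|x 0 i| `^ r) `^ r^-1
  | +oo%E => \big[Num.max/0]_(i < d) `|x 0 i|
  | -oo%E => 0 (* junk, excluded by 1 <= kappa *)
  end.

(* Only the restriction of theta to [0, +oo[ matters. *)
Definition dgood (R : realType) (d : nat) (theta : R -> R) : Prop :=
  [/\ forall x, 0 <= x -> 0 <= theta x,
      forall x y, 0 <= x -> x <= y -> theta y <= theta x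
    & exists rho : nat -> R,
        [/\ forall m, 0 < rho m,
            cvgn (series rho)
          & cvgn (series (fun m : nat =>
              m%:R ^+ (2 * d) * theta m%:R * (rho m)^-1))]].

Definition measure_preserving (R : realType) (disp : measure_display)
  (Om : measurableType disp) (P : probability Om R) (S : Om -> Om) : Prop :=
  measurable_fun [set: Om] S /\
  forall A, measurable A -> P (S @^-1` A) = P A.

(* S ^ n for n : int, where Sinv is the inverse of S. *)
Definition iterz (X : Type) (S Sinv : X -> X) (n : int) : X -> X :=
  match n with
  | Posz m => iter m S
  | Negz m => iter m.+1 Sinv
  end.

(* T^j = T_1 ^ j_1 \o ... \o T_d ^ j_d *)
Definition Zd_act (X : Type) (d : nat) (T Tinv : 'I_d -> X -> X)
  (j : 'rV[int]_d) : X -> X :=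
  \big[(fun f g => f \o g)/idfun]_(i < d) iterz (T i) (Tinv i) (j 0 i).

Definition ergodic_sum (R : realType) (X : Type) (d : nat)
  (T Tinv : 'I_d -> X -> X) (psi : 'rV[R]_d -> R) (f : X -> R) (n : nat)
  (w : X) : \bar R :=
  normalized_sum n (fun j : 'rV[int]_d =>
    psi (scaled R n j) * f (Zd_act T Tinv j w)).

Definition invariant_sets (disp : measure_display) (Om : measurableType disp)
  (d : nat) (T : 'I_d -> Om -> Om) : set (set Om) :=
  [set A | measurable A /\ forall k, T k @^-1` A = A].

Definition is_condexp (R : realType) (disp : measure_display)
  (Om : measurableType disp) (P : probability Om R) (G : set (set Om))
  (f g : Om -> R) : Prop :=
  [/\ forall B : set R, measurable B -> G (g @^-1` B),
      P.-integrable [set: Om] (EFin \o g)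
    & forall A, G A ->
        (\int[P]_(x in A) (g x)%:E = \int[P]_(x in A) (f x)%:E)%E].

(* A version of E[f | G]; see condexpP for its existence. *)
Definition condexp (R : realType) (disp : measure_display)
  (Om : measurableType disp) (P : probability Om R) (G : set (set Om))
  (f : Om -> R) : Om -> R :=
  xget (fun=> 0) [set g | is_condexp P G f g].

Lemma pushforward_density (R : realType) (d1 d2 : measure_display)
  (X : measurableType d1) (Y : measurableType d2) (P : probability X R)
  (phi : X -> Y) (f : X -> R) :
  measurable_fun [set: X] phi -> P.-integrable [set: X] (EFin \o f) ->
  exists h : Y -> R, [/\ measurable_fun [set: Y] h,
    P.-integrable [set: X] (EFin \o (h \o phi))
  & forall A, measurable A ->
      (\int[P]_(x in phi @^-1` A) (h (phi x))%:E =
       \int[P]_(x in phi @^-1` A) (f x)%:E)%E].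
Proof.
move=> mphi intf.
have mpre A : measurable A -> measurable (phi @^-1` A).
  by move=> mA; rewrite -[X in measurable X]setTI; exact: mphi.
have mf := measurable_int _ intf.
pose muf : set Y -> \bar R := pushforward P phi.
have muf0 : muf set0 = 0%E by rewrite /muf /pushforward preimage_set0 measure0.
have muf_ge0 A : (0 <= muf A)%E by exact: measure_ge0.
have tpre (F : (set Y)^nat) : trivIset setT F ->
    trivIset setT (fun n => phi @^-1` F n).
  move=> tF i j _ _ [x [Fi Fj]]; apply: tF => //; by exists (phi x).
have muf_sa : semi_sigma_additive muf.
  move=> F mF tF mUF; rewrite /muf /pushforward preimage_bigcup.
  apply: measure_semi_sigma_additive; [by move=> n; exact: mpre|exact: tpre|].
  by rewrite -preimage_bigcup; exact: mpre.
have mufT : muf [set: Y] = 1%E.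
  by rewrite /muf /pushforward preimage_setT probability_setT.
pose muM : {measure set Y -> \bar R} :=
  HB.pack muf (isMeasure.Build _ _ _ muf muf0 muf_ge0 muf_sa).
pose mu : probability Y R :=
  HB.pack (muM : set Y -> \bar R) muM
    (Measure_isProbability.Build _ _ _ muM mufT).
pose nuf : set Y -> \bar R := pushforward (induced_charge intf) phi.
have nuf0 : nuf set0 = 0%E by rewrite /nuf /pushforward preimage_set0 charge0.
have nuf_fin A : measurable A -> nuf A \is a fin_num.
  by move=> /mpre; exact: fin_num_measure.
have nuf_sa : semi_sigma_additive nuf.
  move=> F mF tF mUF; rewrite /nuf /pushforward preimage_bigcup.
  apply: charge_semi_sigma_additive; [by move=> n; exact: mpre|exact: tpre|].
  by rewrite -preimage_bigcup; exact: mpre.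
pose nu : {charge set Y -> \bar R} :=
  HB.pack nuf (isCharge.Build _ _ _ nuf nuf0 nuf_fin nuf_sa).
have numu : nu `<< mu.
  apply/null_content_dominatesP => A mA muA.
  rewrite /nu /= /nuf /pushforward /induced_charge.
  apply: null_set_integral => //; first exact: mpre.
  exact: measurable_funS mf.
have hfin x : Radon_Nikodym nu mu x \is a fin_num.
  exact: Radon_Nikodym_fin_num.
have inth := Radon_Nikodym_integrable numu.
have hE := fun A => Radon_Nikodym_integral (A := A) numu.
move: (Radon_Nikodym nu mu) => g in hfin inth hE.
have mg := measurable_int _ inth.
have gE : EFin \o (fine \o g) = g by apply/funext => x /=; rewrite fineK.
have intg : P.-integrable [set: X] (g \o phi).
  move/integrableP : inth => [_ glt].
  apply/integrableP; split; first exact: measurableT_comp.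
  apply: le_lt_trans glt; rewrite le_eqVlt; apply/orP; left; apply/eqP.
  symmetry.
  apply: (@ge0_integral_pushforward _ _ _ _ _ phi mphi P setT (abse \o g)) => //.
    exact: measurableT_comp.
  by move=> y _ /=.
exists (fine \o g); split.
- exact: measurableT_comp.
- by rewrite compA gE.
- move=> A mA.
  transitivity (\int[P]_(x in phi @^-1` A) (g \o phi) x)%E.
    by apply: eq_integral => x _ /=; rewrite fineK.
  transitivity (\int[mu]_(x in A) g x)%E; last by rewrite -hE.
  symmetry; apply: (@integral_pushforward _ _ _ _ _ phi mphi P A g) => //.
  by apply: integrableS intg => //; exact: mpre.
Qed.

Lemma condexpP (R : realType) (disp : measure_display)
  (Om : measurableType disp) (P : probability Om R) (G : set (set Om))
  (f : Om -> R) :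
  sigma_algebra [set: Om] G -> G `<=` measurable ->
  P.-integrable [set: Om] (EFin \o f) -> is_condexp P G f (condexp P G f).
Proof.
move=> sG Gm intf; rewrite /condexp; case: xgetP => [g _ //|noG].
suff [g /noG//] : exists g, is_condexp P G f g.
pose Y : measurableType _ := g_sigma_algebraType G.
have YE : @measurable _ Y = G by rewrite -[RHS](sigma_algebra_id sG).
have mphi : measurable_fun [set: Om] (idfun : Om -> Y).
  by move=> _ A; rewrite setTI YE => /Gm.
have [h [mh inth hE]] := pushforward_density mphi intf.
exists h; split => //.
- by move=> B mB; rewrite -YE -[X in measurable X]setTI; exact: (mh _ B mB).
- by move=> A GA; apply: hE; rewrite YE.
Qed.

Lemma invariant_sets_sigma_algebra (disp : measure_display)
  (Om : measurableType disp) (d : nat) (T : 'I_d -> Om -> Om) :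
  sigma_algebra [set: Om] (invariant_sets T) /\
  invariant_sets T `<=` measurable.
Proof.
split; last by move=> A [].
split.
- by split=> // k; rewrite preimage_set0.
- move=> A [mA TA]; split; first by rewrite setTD; exact: measurableC.
  by move=> k; rewrite setTD -preimage_setC TA.
- move=> F FT; split; first by apply: bigcup_measurable => n _; case: (FT n).
  by move=> k; rewrite preimage_bigcup; apply: eq_bigcupr => n _; apply: (FT n).2.
Qed.

(* Main.v *)
(* The proof is the classical one for multiparameter ergodic averages: a maximal
   inequality plus convergence on a dense class.

   Decompose |psi(j/n)| according to the level m = floor(|j|_oo / n). Since
   sum_m theta(m) (m+1)^d is finite, the kernel averages of |f| are dominated,
   uniformly in n, by a constant times sup_N N^-d sum_(|j|_oo <= N) |f(T^j w)|,
   and this supremum satisfies a weak type (1,1) inequality, by a Vitali covering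
   argument in Z^d transferred to the probability space.

   By (ii) the averages of a bounded coboundary h - h o T_i tend to 0, and by
   (iii) those of an invariant function g tend to c g. Garsia's maximal lemma
   gives the Birkhoff theorem for each T_i on bounded functions; applying it to
   T_1, ..., T_d successively, a bounded function is, up to an arbitrarily small
   L^1 error, an invariant function plus coboundaries. The maximal inequality
   absorbs the error.

   For the L^p statement, truncate f: the averages are bounded on L^p uniformly in
   n, hence so is their a.s. limit by Fatou, and dominated convergence applies to
   the truncation. *)
Require Import Defs.
From mathcomp Require Import all_boot all_order all_algebra.
From mathcomp Require Import all_classical all_reals all_analysis.
From mathcomp Require Import measurable_realfun.
From mathcomp Require Import zify ring lra.
Set Implicit Arguments.
Unset Strict Implicit.
Unset Printing Implicit Defensive.
Import Order.TTheory GRing.Theory Num.Theory.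
Import numFieldNormedType.Exports.
Local Open Scope classical_set_scope.
Local Open Scope ring_scope.

(** The approximation only produces some invariant function g, while the limit has to be E[f | I].
    The two are tied together by an L^1 contraction: the integral of |E[f | I] - g| is at most that
    of |f - g - z| for every coboundary z. Markov's inequality then treats this error just as the
    maximal inequality treats the remainder f - g - z. Linearity and L^p bounds of the conditional
    expectation are not proved beforehand: they are read off the averages, up to the factor c, from
    the uniqueness of a.s. limits and from Fatou. Along one orbit everything is deterministic and
    expressed by sums over cubes, normalized by N^d; probability enters through the size of the set
    where such sums are large. The same cube bounds give the absolute summability on which the
    additivity of [fsum] rests. Constants: 10^d is 5^d times 2^d, where 5 comes from doubling the
    balls of the covering and 2 from comparing a cube with its core; 3^d comes from counting the
    points of a cube, 2N + 1 <= 3N. *)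

(** * Maximal inequality *)

(* Greedy choice: a ball of maximal radius is disjoint from every ball whose
   centre lies outside its double. *)
Lemma vitali_counting (R : realType) (X : finType) (dist : X -> X -> nat)
  (r : X -> nat) (C lam : R) (a : X -> R) (S U : {set X}) :
  (forall x, dist x x = 0%N) ->
  (forall x y, dist x y = dist y x) ->
  (forall x y z, (dist x z <= dist x y + dist y z)%N) ->
  (forall x, 0 <= a x) -> 0 <= lam -> 0 <= C ->
  (forall x, x \in S ->
     lam * #|[pred y | dist x y <= 2 * r x]%N|%:R
       <= C * \sum_(y in U | (dist x y <= r x)%N) a y) ->
  lam * #|S|%:R <= C * \sum_(y in U) a y.
Proof.
move=> d0 dsym dtri a0 lam0 C0.
have [n] := ubnP #|S|; elim: n => // n IH in S U * => Sn Sr.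
have [->|[x0 x0S]] := set_0Vmem S.
  by rewrite cards0 mulr0 mulr_ge0// sumr_ge0.
have [x xS xmax] : exists2 x, x \in S & forall y, y \in S -> (r y <= r x)%N.
  by case: (@arg_maxnP _ x0 (mem S) r x0S) => i iS ir; exists i.
pose B := [set y | (dist x y <= r x)%N]%SET.
pose D := [set y | (dist x y <= 2 * r x)%N]%SET.
have x_D : x \in D by rewrite /D inE d0.
have S'S : (#|S :\: D| < #|S|)%N.
  apply: proper_card; rewrite properE subsetDl /=; apply/subsetPn;
    exists x => //.
  by rewrite inE x_D.
have cS : (#|S| <= #|D| + #|S :\: D|)%N.
  by rewrite -(cardsID D S) leq_add2r subset_leq_card// subsetIr.
have IHS : lam * #|S :\: D|%:R <= C * \sum_(y in U :\: B) a y.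
  apply: IH; first exact: leq_trans S'S _.
  move=> y; rewrite /D !inE => /andP[xy yS].
  apply: le_trans (Sr _ yS) _; rewrite ler_wpM2l//.
  rewrite le_eqVlt; apply/orP; left; apply/eqP; apply: eq_bigl => z.
  rewrite /B !inE; have [yz|] := boolP (dist y z <= r y)%N;
    last by rewrite !andbF.
  have -> : (dist x z <= r x)%N = false => //.
  apply/negbTE; move: xy; rewrite -!ltnNge => xy.
  have := dtri x z y; have := xmax y yS; rewrite (dsym z y); lia.
have SD : lam * #|D|%:R <= C * \sum_(y in U | (dist x y <= r x)%N) a y.
  by rewrite /D cardsE; exact: Sr.
apply: (@le_trans _ _ (lam * #|D|%:R + lam * #|S :\: D|%:R)).
  by rewrite -mulrDr -natrD ler_wpM2l// ler_nat.
apply: le_trans (lerD SD IHS) _; rewrite -mulrDr ler_wpM2l//.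
rewrite [leRHS](bigID (fun y => dist x y <= r x)%N)/= lerD2l.
by rewrite le_eqVlt; apply/orP; left; apply/eqP; apply: eq_bigl => z;
  rewrite !inE andbC.
Qed.

(** The map k -> k + r - i is injective into 2r + 1 values; the truncated subtraction is exact
    because i <= k + r. *)
Lemma card_near_ord (n : nat) (i : 'I_n) (r : nat) :
  (#|[pred k : 'I_n | (k <= i + r)%N && (i <= k + r)%N]| <= (2 * r).+1)%N.
Proof.
pose g (k : 'I_n) : 'I_(2 * r).+1 := inord (k + r - i).
rewrite -[leqRHS]card_ord -(@card_in_image _ _ g); first exact: max_card.
move=> k l; rewrite !inE /= => /andP[k1 k2] /andP[l1 l2] /(congr1 val).
by rewrite /= !inordK ?ltnS; [move=> ?; apply: val_inj => /=; lia|lia|lia].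
Qed.

(** One of the two truncated differences vanishes, so this is the sup distance computed in [nat]. *)
Definition cube_dist {d n : nat} (x y : {ffun 'I_d -> 'I_n}) : nat :=
  \max_(k < d) ((x k - y k) + (y k - x k)).

Lemma cube_dist_le d n (x y : {ffun 'I_d -> 'I_n}) (r : nat) :
  (cube_dist x y <= r)%N =
  [forall k, (y k <= x k + r)%N && (x k <= y k + r)%N].
Proof.
rewrite /cube_dist; apply/bigmax_leqP/forallP => H k; first by have :=
  H k isT; lia.
by move=> _; have := H k; lia.
Qed.

Lemma card_cube_ball d n (x : {ffun 'I_d -> 'I_n}) (r : nat) :
  (#|[pred y | cube_dist x y <= r]%N| <= (2 * r).+1 ^ d)%N.
Proof.
pose F k := [pred i : 'I_n | (i <= x k + r)%N && (x k <= i + r)%N].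
have -> : #|[pred y | cube_dist x y <= r]%N| = #|family F|.
  apply: eq_card => y; rewrite !inE cube_dist_le; apply/forallP/familyP => H k;
  by have := H k; rewrite ?inE.
rewrite card_family foldrE big_map -[d in (_ ^ d)%N](card_ord d).
rewrite big_enum -prod_nat_const; apply: leq_prod => k _.
by rewrite (eq_card (B := [pred i : 'I_n | (i <= x k + r)%N &&
  (x k <= i + r)%N]))
  ?card_near_ord.
Qed.

Lemma leq_expr (m n d : nat) : (m <= n)%N -> (m ^ d <= n ^ d)%N.
Proof. by case: d => // d mn; rewrite leq_exp2r. Qed.

Definition zball {d : nat} (N : nat) : set 'rV[int]_d :=
  [set j : 'rV[int]_d | forall k : 'I_d, (absz (j 0%R k) <= N)%N].

Lemma esum_fin_image (R : realType) (I : finType) (V : choiceType)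
  (A : pred I) (v : I -> V) (a : V -> R) : injective v ->
  (forall i, 0 <= a i) ->
  (\esum_(j in v @` [set i | A i]) (a j)%:E)%E =
  (\sum_(i | A i) a (v i))%:E.
Proof.
move=> vI a0; rewrite esum_image; last by move=> x y _ _; exact: vI.
rewrite esum_mkcond esum_fset; [|exact: finite_finset|]; last first.
  by move=> i _; case: ifP; rewrite ?lee_fin.
have -> : [set: I] = [set` index_enum I].
  by rewrite eqEsubset; split => // i _ /=; rewrite mem_index_enum.
rewrite -fsbig_seq ?index_enum_uniq//= [in RHS]big_mkcond -sumEFin; apply:
  eq_bigr => i _.
by have [Ai|nAi] := boolP (A i); [rewrite mem_set|rewrite memNset//;
  exact/negP].
Qed.

Definition cube_pt {d n : nat} (x : {ffun 'I_d -> 'I_n}) : 'rV[int]_d :=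
  \row_k (x k)%:Z.

Lemma cube_pt_inj d n : injective (@cube_pt d n).
Proof.
move=> x y /matrixP xy; apply/ffunP => k; apply: val_inj.
by have := xy 0 k; rewrite !mxE => -[].
Qed.

(** Balls of radius at most L around a point that keeps distance L from the faces are not cut off by
    the cube. A finite sum inside the cube is then a full sum over a ball of Z^d. *)
Lemma zball_cube d n L N (x : {ffun 'I_d -> 'I_n}) :
  (forall k : 'I_d, (L <= x k)%N && (x k + L < n)%N) -> (N <= L)%N ->
  zball N = (fun y => cube_pt y - cube_pt x) @`
    [set y : {ffun 'I_d -> 'I_n} | (cube_dist x y <= N)%N].
Proof.
move=> xL NL; rewrite eqEsubset; split=> j /=.
  move=> jN.
  have jb (k : 'I_d) : (absz (j 0 k + (x k)%:Z)%R < n)%N.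
    by have := jN k; have /andP[] := xL k; lia.
  exists [ffun k => Ordinal (jb k)].
    rewrite cube_dist_le; apply/forallP => k; rewrite ffunE /=.
    by have := jN k; have /andP[] := xL k; lia.
  apply/rowP => k; rewrite !mxE ffunE /=.
  by have := jN k; have /andP[] := xL k; lia.
move=> [y]; rewrite cube_dist_le => /forallP xy <- k; rewrite !mxE.
by have := xy k; lia.
Qed.

Lemma card_cube_core (d L : nat) :
  #|[pred x : {ffun 'I_d -> 'I_(4 * L)} |
      [forall k, (L <= x k)%N && (x k < 3 * L)%N]]| = ((2 * L) ^ d)%N.
Proof.
pose F (k : 'I_d) := [pred i : 'I_(4 * L) | (L <= i)%N && (i < 3 * L)%N].
transitivity #|family F|.
  by apply: eq_card => y; rewrite !inE.
rewrite card_family foldrE big_map -[d in (_ ^ d)%N](card_ord d).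
rewrite big_enum -prod_nat_const; apply: eq_bigr => k _.
have h (i : 'I_(2 * L)) : (i + L < 4 * L)%N by have := ltn_ord i; lia.
rewrite -[RHS]card_ord -(card_imset _ (f := fun i => Ordinal (h i)));
  last first.
  by move=> i j /(congr1 val)/= ij; apply: val_inj => /=; lia.
apply: eq_card => i; rewrite inE; apply/andP/imsetP => [[Li i3L]|[l _ ->] /=].
  have hi : (i - L < 2 * L)%N by lia.
  by exists (Ordinal hi) => //; apply: val_inj => /=; lia.
by have := ltn_ord l; lia.
Qed.

(** The deterministic half of the transference argument, along a single orbit: the covering lemma is
    applied to the core points satisfying E. Restricting the centres to the core keeps every
    selected ball inside the cube. *)
Lemma transference_count (R : realType) (d L : nat) (lam : R)
  (F : 'rV[int]_d -> R) (E : {ffun 'I_d -> 'I_(4 * L)} -> Prop) :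
  0 <= lam -> (forall j, 0 <= F j) ->
  (forall x, E x -> exists N, [/\ (0 < N)%N, (N <= L)%N &
     ((lam * N%:R ^+ d)%:E <= \esum_(i in zball N) (F (i + cube_pt x))%:E)%E])
       ->
  lam * (\sum_(x : {ffun 'I_d -> 'I_(4 * L)} |
      [forall k, (L <= x k)%N && (x k < 3 * L)%N]) (`[< E x >])%:R)
    <= 5 ^+ d * \sum_(x : {ffun 'I_d -> 'I_(4 * L)}) F (cube_pt x).
Proof.
move=> lam0 F0 EN.
pose core (x : {ffun 'I_d -> 'I_(4 * L)}) :=
  [forall k, (L <= x k)%N && (x k < 3 * L)%N].
(* The default radius 0 is taken only where E fails, and such points are not in [S]. *)
pose r (x : {ffun 'I_d -> 'I_(4 * L)}) := xget 0%N [set N | [/\ (0 < N)%N,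
  (N <= L)%N &
     ((lam * N%:R ^+ d)%:E <= \esum_(i in zball N) (F (i + cube_pt x))%:E)%E]].
have rP x : E x -> [/\ (0 < r x)%N, (r x <= L)%N &
   ((lam * (r x)%:R ^+ d)%:E <= \esum_(i in zball (r x))
     (F (i + cube_pt x))%:E)%E].
  by move=> /EN xN; rewrite /r; case: xgetP => [_ _ //|]; case: xN => N +
    h => /h.
pose S := [set x | core x && `[< E x >]]%SET.
have -> : (\sum_(x | core x) (`[< E x >])%:R : R) = #|S|%:R.
  rewrite -sum1_card natr_sum big_mkcond [RHS]big_mkcond; apply: eq_bigr => x _.
  by rewrite inE; case: (core x); case: `[< _ >].
rewrite (eq_bigl (mem [set: {ffun 'I_d -> 'I_(4 * L)}]%SET)); last by move=> x;
  rewrite /= inE.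
apply: (@vitali_counting _ _ cube_dist r) => //.
- move=> x; apply/eqP; rewrite -leqn0 cube_dist_le; apply/forallP => k; lia.
- by move=> x y; apply: eq_bigr => k _; rewrite addnC.
- move=> x y z; rewrite cube_dist_le; apply/forallP => k.
  have := leqnn (cube_dist x y); rewrite {1}cube_dist_le => /forallP /(_ k).
  have := leqnn (cube_dist y z); rewrite {1}cube_dist_le => /forallP /(_ k).
  lia.
- move=> x; rewrite inE => /andP[/forallP xc /asboolP /rP [r0 rL rE]].
  (* The doubled ball has at most (4r + 1)^d <= (5r)^d points, since r > 0. *)
  apply: (@le_trans _ _ (5 ^+ d * (lam * (r x)%:R ^+ d))).
    rewrite mulrCA ler_wpM2l// -exprMn -natrM -natrX ler_nat.
    apply: leq_trans (card_cube_ball _ _) _.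
    by apply: leq_expr; lia.
  rewrite ler_wpM2l ?exprn_ge0// -lee_fin; apply: le_trans rE _.
  rewrite (zball_cube (n := 4 * L) (L := L) (x := x))//; last first.
    by move=> k; have := xc k; lia.
  rewrite (@esum_fin_image _ _ _ _ _ (fun i => F (i + cube_pt x)))//;
    last first.
    by move=> y z /addIr /cube_pt_inj.
  rewrite lee_fin le_eqVlt; apply/orP; left; apply/eqP.
  by apply: eq_big => [y|y _]; rewrite ?finset.in_setT ?subrK.
Qed.

(** * The action of Z^d *)

Section iterz.
Context (X : Type) (S Sinv : X -> X) (SK : cancel S Sinv)
  (SinvK : cancel Sinv S).

(** The delicate case is the passage from -1, which is [Negz 0], to 0: there [S] cancels the only
    [Sinv]. *)
Lemma iterzS n x : iterz S Sinv (n + 1) x = S (iterz S Sinv n x).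
Proof.
case: n => [n|[|n]]; first by rewrite -PoszD addn1.
- by rewrite NegzE addNr /= SinvK.
- rewrite (_ : Negz n.+1 + 1 = Negz n) /= ?SinvK//.
  by rewrite !NegzE; lia.
Qed.

Lemma iterzP n x : iterz S Sinv (n - 1) x = Sinv (iterz S Sinv n x).
Proof. by rewrite -[in RHS](subrK 1 n) iterzS SK. Qed.

Lemma iterzD m n x : iterz S Sinv (m + n) x = iterz S Sinv m (iterz S Sinv n x).
Proof.
elim/int_rect: m => [|m IH|m IH]; first by rewrite add0r.
- by rewrite -addn1 PoszD -addrA (addrC 1) addrA !iterzS IH.
- have -> : - (m.+1%:Z) = - m%:Z - 1 :> int by lia.
  by rewrite -addrA (addrC (-1)) addrA !iterzP IH.
Qed.

Lemma iterz_comm U n x : (forall y, S (U y) = U (S y)) ->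
  iterz S Sinv n (U x) = U (iterz S Sinv n x).
Proof.
move=> SU; have SinvU y : Sinv (U y) = U (Sinv y).
  by rewrite -{1}(SinvK y) -SU SK.
have iterC V m y : (forall z, V (U z) = U (V z)) -> iter m V (U y) =
  U (iter m V y).
  by move=> VU; elim: m => //= m ->.
by case: n => n /=; rewrite ?iterC.
Qed.

(** Stated for predicates; a function g is handled through the predicate g z = g y with y fixed. *)
Lemma iterz_inv (f : X -> Prop) n x : (forall y, f (S y) <-> f y) ->
  f (iterz S Sinv n x) <-> f x.
Proof.
move=> fS; have fSinv y : f (Sinv y) <-> f y by rewrite -fS SinvK.
elim/int_rect: n => [|m IH|m IH] //.
- by rewrite -addn1 PoszD iterzS fS.
- have -> : - (m.+1%:Z) = - m%:Z - 1 :> int by lia.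
  by rewrite iterzP fSinv.
Qed.

End iterz.

(** Composition is not a commutative law, so the splitting of a product of products has to be
    derived from the commutation of each F i with each G k. *)
Lemma big_comp_split (X : Type) (I : Type) (s : seq I) (F G : I -> X -> X) x :
  (forall i k y, F i (G k y) = G k (F i y)) ->
  (\big[(fun f g => f \o g)/idfun]_(i <- s) (F i \o G i)) x =
  (\big[(fun f g => f \o g)/idfun]_(i <- s) F i)
    ((\big[(fun f g => f \o g)/idfun]_(i <- s) G i) x).
Proof.
move=> FG; elim: s x => [|i s IH] x; first by rewrite !big_nil.
rewrite !big_cons /= IH; congr F.
rewrite -[LHS]/((G i \o _) _).
have comm y : G i ((\big[(fun f g => f \o g)/idfun]_(j <- s) F j) y) =
    (\big[(fun f g => f \o g)/idfun]_(j <- s) F j) (G i y).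
  elim: s y {IH} => [|j s IH] y; first by rewrite !big_nil.
  by rewrite !big_cons /= -FG IH.
by rewrite /= comm.
Qed.

Section Zd_act.
Context (X : Type) (d : nat) (T Tinv : 'I_d -> X -> X).
Context (TK : forall i, cancel (T i) (Tinv i)).
Context (TinvK : forall i, cancel (Tinv i) (T i)).
Context (Tcomm : forall i k, T i \o T k = T k \o T i).

Lemma Zd_actD j k x :
  Zd_act T Tinv (j + k) x = Zd_act T Tinv j (Zd_act T Tinv k x).
Proof.
have TT i l y : T i (T l y) = T l (T i y) by have /(congr1 (@^~ y)) :=
  Tcomm i l.
rewrite /Zd_act -big_comp_split.
  congr (_ x); apply: eq_bigr => i _; apply/funext => y /=.
  by rewrite mxE (iterzD (TK i) (TinvK i)).
move=> i l y; apply: iterz_comm => // z.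
by symmetry; apply: iterz_comm.
Qed.

Lemma Zd_act_delta i x : Zd_act T Tinv (delta_mx 0 i) x = T i x.
Proof.
rewrite /Zd_act; suff H (s : seq 'I_d) : uniq s ->
   (\big[(fun f g => f \o g)/idfun]_(k <- s)
      iterz (T k) (Tinv k) ((delta_mx 0 i : 'rV[int]_d) 0 k)) x =
   if i \in s then T i x else x.
  by rewrite H ?index_enum_uniq// mem_index_enum.
elim: s x => [|k s IH] x; first by rewrite big_nil.
move=> /= /andP[ks us]; rewrite big_cons /= mxE eqxx /= inE IH//.
by have [<-|] := eqVneq k i; [rewrite (negPf ks)|rewrite eq_sym].
Qed.

Lemma Zd_act_inv (Y : Type) (g : X -> Y) j x :
  (forall i y, g (T i y) = g y) -> g (Zd_act T Tinv j x) = g x.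
Proof.
move=> gT; rewrite /Zd_act.
elim: (index_enum _) x => [|i s IH] x; first by rewrite big_nil.
rewrite big_cons /=.
set y := (X in iterz _ _ _ X).
have gy z : g (T i z) = g y <-> g z = g y by rewrite gT.
have [_ ->//] := iterz_inv (TK i) (TinvK i) (f := fun z => g z = g y)
  (j 0 i) y gy.
exact: IH.
Qed.

End Zd_act.

(** * Measure-preserving maps and invariance of integrals *)

Section measure_preserving.
Context (R : realType) (disp : measure_display) (Om : measurableType disp)
  (P : probability Om R).

Lemma measure_preserving_id : measure_preserving P idfun.
Proof. by split => //; exact: measurable_id. Qed.

Lemma measure_preserving_comp S U : measure_preserving P S ->
  measure_preserving P U -> measure_preserving P (S \o U).
Proof.
move=> [mS PS] [mU PU]; split; first exact: measurableT_comp.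
move=> A mA; rewrite comp_preimage PU ?PS//.
by rewrite -[X in measurable X]setTI; exact: mS.
Qed.

Lemma measure_preserving_Zd_act d (T Tinv : 'I_d -> Om -> Om) j :
  (forall i, measure_preserving P (T i)) ->
  (forall i, measure_preserving P (Tinv i)) ->
  measure_preserving P (Zd_act T Tinv j).
Proof.
move=> hT hTinv.
have hiter n S : measure_preserving P S -> measure_preserving P (iter n S).
  move=> hS; elim: n => [|n IH]; first exact: measure_preserving_id.
  exact: (measure_preserving_comp hS IH).
rewrite /Zd_act; apply: (big_ind (measure_preserving P)).
- exact: measure_preserving_id.
- exact: measure_preserving_comp.
- by move=> i _; case: (j 0 i) => n; exact: hiter.
Qed.

Lemma ge0_integral_measure_preserving S (f : Om -> \bar R) :
  measure_preserving P S -> measurable_fun [set: Om] f ->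
  (forall x, 0 <= f x)%E ->
  (\int[P]_x f (S x) = \int[P]_x f x)%E.
Proof.
move=> [mS PS] mf f0.
rewrite -[LHS](ge0_integral_pushforward mS P (D := setT))//.
by apply: eq_measure_integral => A mA _; rewrite /= /pushforward PS.
Qed.

Lemma integral_measure_preserving S (f : Om -> R) :
  measure_preserving P S -> measurable_fun [set: Om] f ->
  (\int[P]_x (f (S x))%:E = \int[P]_x (f x)%:E)%E.
Proof.
move=> hS mf; rewrite [LHS]integralE [RHS]integralE.
have mf' : measurable_fun [set: Om] (EFin \o f) by exact/measurable_EFinP.
congr (_ - _)%E.
- rewrite -[RHS](ge0_integral_measure_preserving hS (measurable_funepos mf'))//.
  by apply: eq_integral => x _; rewrite !funeposE.
- rewrite -[RHS](ge0_integral_measure_preserving hS (measurable_funeneg mf'))//.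
  by apply: eq_integral => x _; rewrite !funenegE.
Qed.

End measure_preserving.

(** * Sums over countable sets and Tonelli's theorem *)

Lemma sume_const (R : realType) (I : finType) (A : pred I) (x : \bar R) :
  (\sum_(i | A i) x = #|A|%:R%:E * x)%E.
Proof.
rewrite -sum1_card natr_sum -sumEFin ge0_sume_distrl; last by move=> i _;
  rewrite lee_fin.
by apply: eq_bigr => i _; rewrite mul1e.
Qed.

(** Enumerating the index set, with 0 at the numbers that code nothing, makes results on series of
    functions available for sums over Z^d. *)
Lemma esum_pickle (R : realType) (I : countType) (a : I -> \bar R) :
  (forall i, 0 <= a i)%E ->
  (\esum_(i in [set: I]) a i =
   \sum_(k <oo) (if pickle_inv k is Some i then a i else 0))%E.
Proof.
move=> a0; pose b k : \bar R := if @pickle_inv I k is Some i then a i else 0%E.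
have b0 k : (0 <= b k)%E by rewrite /b; case: pickle_inv.
rewrite nneseries_esumT//.
have -> : (\esum_(i in [set: I]) a i = \esum_(i in [set: I]) b (pickle i))%E.
  by apply: eq_esum => i _; rewrite /b pickleK_inv.
rewrite -(esum_image _ pickle); last by move=> i j _ _; exact:
  (pcan_inj pickleK_inv).
rewrite esum_mkcond; apply: eq_esum => k _.
case: ifPn => // /negP; rewrite inE => nk; rewrite /b.
case E : (pickle_inv k) => [i|//]; exfalso; apply: nk; exists i => //.
by have := @pickle_invK I k; rewrite /oapp E.
Qed.

Section tonelli.
Context (R : realType) (disp : measure_display) (Om : measurableType disp)
  (mu : {measure set Om -> \bar R}) (I : countType).
Context (a : I -> Om -> \bar R).
Context (ma : forall i, measurable_fun [set: Om] (a i)).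
Context (a0 : forall i x, (0 <= a i x)%E).

Lemma measurable_fun_esum (D : set I) :
  measurable_fun [set: Om] (fun x => \esum_(i in D) a i x)%E.
Proof.
pose b x i := if i \in D then a i x else 0%E.
rewrite (_ : (fun _ => _) = fun x =>
    \sum_(k <oo) (if pickle_inv k is Some i then b x i else 0))%E; last first.
  by apply/funext => x; rewrite esum_mkcond esum_pickle// => i; rewrite /b;
    case: ifP.
rewrite /b {b}.
apply: ge0_emeasurable_sum.
  by move=> k x _ _; case: pickle_inv => // i; case: ifP.
move=> k _; case: pickle_inv => [i|]; last exact: measurable_cst.
by case: (i \in D); [exact: ma|exact: measurable_cst].
Qed.

Lemma ge0_integral_esum :
  (\int[mu]_x (\esum_(i in [set: I]) a i x) =
   \esum_(i in [set: I]) \int[mu]_x a i x)%E.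
Proof.
rewrite esum_pickle; last by move=> i; exact: integral_ge0.
under eq_integral do rewrite esum_pickle//.
rewrite integral_nneseries//.
- apply: eq_eseriesr => k _; case: pickle_inv => //.
  exact: integral0.
- by move=> k; case: pickle_inv => // i.
- by move=> k x _; case: pickle_inv.
Qed.

End tonelli.

(** * The weak type (1,1) inequality *)

Section maximal_inequality.
Context (R : realType) (disp : measure_display) (Om : measurableType disp)
  (P : probability Om R) (d : nat) (T Tinv : 'I_d -> Om -> Om).
Context (hTK : forall i, cancel (T i) (Tinv i)).
Context (hTinvK : forall i, cancel (Tinv i) (T i)).
Context (hT : forall i, measure_preserving P (T i)).
Context (hTinv : forall i, measure_preserving P (Tinv i)).
Context (hTcomm : forall i k, T i \o T k = T k \o T i).

(** The superlevel set of the maximal function sup over N >= 1 of N^-d times the sum over the cube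
    of radius N, written without forming the supremum. *)
Definition max_exceeds (F : Om -> R) (lam : R) : set Om :=
  [set w | exists2 N, (0 < N)%N &
    ((lam * N%:R ^+ d)%:E < \esum_(i in zball N) (F (Zd_act T Tinv i w))%:E)%E].

Context (F : Om -> R) (mF : measurable_fun [set: Om] F) (F0 : forall w,
  0 <= F w).

Let mFact j : measurable_fun [set: Om] (fun w => F (Zd_act T Tinv j w)).
Proof. exact: (measurableT_comp mF (measure_preserving_Zd_act j hT hTinv).1).
  Qed.

Let ballset lam N : set Om := [set w |
  ((lam * N%:R ^+ d)%:E < \esum_(i in zball N) (F (Zd_act T Tinv i w))%:E)%E].

Let measurable_ballset lam N : measurable (ballset lam N).
Proof.
rewrite -[X in measurable X]setTI; apply: emeasurable_fun_o_infty => //.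
apply: measurable_fun_esum => [i|i x]; last by rewrite lee_fin.
exact/measurable_EFinP.
Qed.

Let max_upto lam L : set Om := \bigcup_(N in [set N | (0 < N <= L)%N])
  ballset lam N.

(* Integrate the covering inequality over the orbit points of the cube of side 4L,
   centres being restricted to its core of side 2L. *)
Let max_upto_le lam L : 0 <= lam -> (0 < L)%N ->
  (lam%:E * P (max_upto lam L) <= (10 ^+ d)%:E * \int[P]_w (F w)%:E)%E.
Proof.
move=> lam0 L0; pose E := max_upto lam L.
have mE : measurable E by apply: bigcup_measurable => N _.
pose core (x : {ffun 'I_d -> 'I_(4 * L)}) :=
  [forall k, (L <= x k)%N && (x k < 3 * L)%N].
pose s := [seq x <- index_enum _ | core x].
have actE (x : {ffun 'I_d -> 'I_(4 * L)}) w : E (Zd_act T Tinv (cube_pt x) w) ->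
  exists N, [/\ (0 < N)%N, (N <= L)%N &
     ((lam * N%:R ^+ d)%:E <= \esum_(i in zball N)
       (F (Zd_act T Tinv (i + cube_pt x) w))%:E)%E].
  move=> [N /= /andP[N0 NL] wN]; exists N; split=> //.
  by under eq_esum do rewrite Zd_actD//; exact: ltW.
have count w : (lam%:E * \sum_(x <- s)
      (\1_E (Zd_act T Tinv (cube_pt x) w))%:E
   <= (5 ^+ d)%:E * \sum_(x : {ffun 'I_d -> 'I_(4 * L)})
     (F (Zd_act T Tinv (cube_pt x) w))%:E)%E.
  have := @transference_count R d L lam (fun j => F (Zd_act T Tinv j w))
    (fun x => E (Zd_act T Tinv (cube_pt x) w)) lam0 (fun j => F0 _)
      (fun x => @actE x w).
  rewrite /s big_filter !sumEFin -!EFinM lee_fin; apply: le_trans.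
  by rewrite ler_wpM2l.
have m1E j : measurable_fun [set: Om] (fun w => (\1_E (Zd_act T Tinv j w))%:E :
  \bar R).
  have m1 : measurable_fun [set: Om] (\1_E : Om -> R) by exact:
    measurable_indic.
  apply/measurable_EFinP.
  exact: (measurableT_comp m1 (measure_preserving_Zd_act j hT hTinv).1).
have mFj j : measurable_fun [set: Om] (fun w => (F (Zd_act T Tinv j w))%:E).
  exact/measurable_EFinP.
have : (\int[P]_w (lam%:E * \sum_(x <- s)
      (\1_E (Zd_act T Tinv (cube_pt x) w))%:E)
   <= \int[P]_w ((5 ^+ d)%:E * \sum_(x : {ffun 'I_d -> 'I_(4 * L)})
         (F (Zd_act T Tinv (cube_pt x) w))%:E))%E.
  apply: ge0_le_integral => //.
  - by move=> w _; apply: mule_ge0; [rewrite lee_fin|apply: sume_ge0 => x _;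
      rewrite lee_fin].
  - by apply: emeasurable_funM => //; exact: emeasurable_sum.
  - by apply: emeasurable_funM => //; exact: emeasurable_sum.
rewrite ge0_integralZl_EFin//; last 2 first.
- by move=> w _; apply: sume_ge0 => x _; rewrite lee_fin.
- exact: emeasurable_sum.
rewrite ge0_integralZl_EFin//; last 2 first.
- by move=> w _; apply: sume_ge0 => x _; rewrite lee_fin.
- exact: emeasurable_sum.
rewrite ge0_integral_sum//.
rewrite /s big_filter ge0_integral_sum//; last by move=> x w _; rewrite lee_fin.
have -> : (\sum_(x : {ffun 'I_d -> 'I_(4 * L)} | core x)
    \int[P]_w (\1_E (Zd_act T Tinv (cube_pt x) w))%:E =
      ((2 * L) ^ d)%:R%:E * P E)%E.
  rewrite (eq_bigr (fun=> P E)) => [|x _].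
    by rewrite sume_const card_cube_core.
  have m1 : measurable_fun [set: Om] (EFin \o (\1_E : Om -> R)).
    by apply/measurable_EFinP; exact: measurable_indic.
  rewrite [LHS](ge0_integral_measure_preserving
    (measure_preserving_Zd_act (cube_pt x) hT hTinv) m1).
    by rewrite integral_indic// setIT.
  by move=> w; rewrite /= lee_fin.
have -> : (\sum_(x : {ffun 'I_d -> 'I_(4 * L)})
    \int[P]_w (F (Zd_act T Tinv (cube_pt x) w))%:E =
    ((4 * L) ^ d)%:R%:E * \int[P]_w (F w)%:E)%E.
  rewrite (eq_bigr (fun=> \int[P]_w (F w)%:E)%E) => [|x _].
    by rewrite sume_const card_ffun !card_ord.
  apply: (ge0_integral_measure_preserving (f := EFin \o F)
    (measure_preserving_Zd_act (cube_pt x) hT hTinv)).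
    exact/measurable_EFinP.
  by move=> w; rewrite /= lee_fin.
rewrite !muleA -!EFinM => H.
(* Division by the number (2L)^d of core points leaves 5^d (4L)^d / (2L)^d = 10^d. *)
have L0' : 0 < ((2 * L) ^ d)%:R :> R by rewrite ltr0n expn_gt0; lia.
rewrite -(@lee_pmul2l _ ((2 * L) ^ d)%:R%:E)//.
rewrite !muleA -!EFinM [X in (X%:E * P E)%E]mulrC; apply: le_trans H _.
rewrite le_eqVlt; apply/orP; left; apply/eqP; congr (_%:E * _)%E.
by rewrite !natrX -!exprMn; congr (_ ^+ d); rewrite !natrM; ring.
Qed.

Lemma measurable_max_exceeds lam : measurable (max_exceeds F lam).
Proof.
rewrite (_ : max_exceeds F lam =
   \bigcup_(N in [set N | (0 < N)%N]) ballset lam N).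
  by apply: bigcup_measurable => N _.
by rewrite eqEsubset; split=> w [N N0 wN]; exists N.
Qed.

(** The bound for radii at most L does not depend on L, so continuity of P along the increasing sets
    [max_upto lam L] removes the restriction. *)
Lemma maximal_inequality lam : 0 <= lam ->
  (lam%:E * P (max_exceeds F lam) <= (10 ^+ d)%:E * \int[P]_w (F w)%:E)%E.
Proof.
move=> lam0.
have mE L : measurable (max_upto lam L) by apply: bigcup_measurable => N _.
have -> : max_exceeds F lam = \bigcup_L max_upto lam L.
  rewrite eqEsubset; split=> w [N].
    by move=> N0 wN; exists N => //; exists N => //=; rewrite N0 leqnn.
  by move=> _ [M /andP[M0 _] wM]; exists M.
have ndE : nondecreasing_seq (max_upto lam).
  move=> m n mn; apply/subsetPset => w [N /= /andP[N0 Nm] wN].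
  by exists N => //=; rewrite N0 (leq_trans Nm).
have cvE : P (max_upto lam L) @[L --> \oo] --> P (\bigcup_L max_upto lam L).
  by apply: nondecreasing_cvg_mu => //; exact: bigcup_measurable.
have cvlE : (lam%:E * P (max_upto lam L))%E @[L --> \oo] -->
    (lam%:E * P (\bigcup_L max_upto lam L))%E by exact: cvgeZl.
apply: (cvge_le _ cvlE) => //.
by exists 1%N => // L /= L0; exact: max_upto_le.
Qed.

End maximal_inequality.

(** * Kernel averages *)

Lemma esumZl (R : realType) (I : countType) (D : set I) (c : R)
  (a : I -> \bar R) :
  0 <= c -> (forall i, 0 <= a i)%E ->
  (\esum_(i in D) (c%:E * a i) = c%:E * \esum_(i in D) a i)%E.
Proof.
move=> c0 a0; rewrite esum_mkcond [in RHS]esum_mkcond !esum_pickle;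
  last 2 first.
- by move=> i; case: ifP.
- by move=> i; case: ifP => // _; rewrite mule_ge0.
rewrite -nneseriesZl; last by move=> k _; case: pickle_inv => // i; case: ifP.
apply: eq_eseriesr => k _; case: pickle_inv => [i|]; last by rewrite mule0.
by case: ifP => // _; rewrite mule0.
Qed.

Lemma le_esum_subset (R : realType) (I : choiceType) (D E : set I)
  (a : I -> \bar R) :
  D `<=` E -> (forall i, 0 <= a i)%E ->
    (\esum_(i in D) a i <= \esum_(i in E) a i)%E.
Proof.
move=> DE a0; rewrite esum_mkcond [leRHS]esum_mkcond; apply: le_esum => i _.
case: ifPn => [|_]; last by case: ifP.
by rewrite inE => /DE iE; rewrite mem_set.
Qed.

(** * Linearity of [fsum] on summable families *)

Section fsum.
Context (R : realType) (I : countType).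
Implicit Types a b : I -> R.

(** Here a and b may be any nonnegative summable families, not just the positive and negative parts
    of a - b. This freedom is what yields additivity of [fsum]. *)
Lemma fsumB a b :
  (\esum_(i in [set: I]) (a i)%:E < +oo)%E -> (\esum_(i in [set: I])
    (b i)%:E < +oo)%E ->
  (forall i, 0 <= a i) -> (forall i, 0 <= b i) ->
  fsum (fun i => a i - b i) =
  (\esum_(i in [set: I]) (a i)%:E - \esum_(i in [set: I]) (b i)%:E)%E.
Proof.
move=> sa sb a0 b0.
have sumN (c : I -> R) : (forall i, 0 <= c i) -> (\esum_(i in [set: I])
  (c i)%:E < +oo)%E ->
    summable [set: I] (EFin \o c).
  by move=> c0 sc; rewrite /summable; under eq_esum do rewrite /= ger0_norm//.
apply: (@esumB R I setT (EFin \o a) (EFin \o b)).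
- exact: sumN.
- exact: sumN.
- by move=> i _; rewrite lee_fin.
- by move=> i _; rewrite lee_fin.
Qed.

Lemma fsum_ge0 a : (forall i, 0 <= a i) ->
  fsum a = (\esum_(i in [set: I]) (a i)%:E)%E.
Proof.
move=> a0; rewrite /fsum [X in (_ - X)%E]esum1 ?sube0; last first.
  by move=> i _; rewrite funenegE /= -EFin_max max_r// oppr_le0.
by apply: eq_esum => i _; rewrite funeposE /= -EFin_max max_l.
Qed.

Definition fsummable a := (\esum_(i in [set: I]) (`|a i|)%:E < +oo)%E.

Lemma fsummable_le a b : (forall i, `|a i| <= `|b i|) -> fsummable b ->
  fsummable a.
Proof.
by move=> ab; apply: le_lt_trans; apply: le_esum => i _; rewrite lee_fin.
Qed.

Lemma fsummableD a b : fsummable a -> fsummable b ->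
  fsummable (fun i => a i + b i).
Proof.
move=> sa sb; have := lte_add_pinfty sa sb; apply: le_lt_trans.
rewrite -esumD//.
by apply: le_esum => i _; rewrite -EFinD lee_fin ler_normD.
Qed.

Let posE a i : a i = Num.max (a i) 0 - Num.max (- a i) 0.
Proof. by case: (leP (a i) 0) => ai; case: (leP (- a i) 0) => nai; lra. Qed.

Lemma fsumE a :
  fsum a = (\esum_(i in [set: I]) (Num.max (a i) 0)%:E -
            \esum_(i in [set: I]) (Num.max (- a i) 0)%:E)%E.
Proof.
rewrite /fsum; congr (_ - _)%E; apply: eq_esum => i _.
- by rewrite funeposE EFin_max.
- by rewrite funenegE EFin_max EFinN.
Qed.

Let spos a : fsummable a -> fsummable (fun i => Num.max (a i) 0).
Proof.
apply: fsummable_le => i; rewrite ger0_norm ?le_max ?lexx ?orbT//.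
by rewrite ge_max ler_norm normr_ge0.
Qed.

Let sneg a : fsummable a -> fsummable (fun i => Num.max (- a i) 0).
Proof.
apply: fsummable_le => i; rewrite ger0_norm ?le_max ?lexx ?orbT//.
by rewrite ge_max -normrN ler_norm normr_ge0.
Qed.

Let sge0 a : (forall i, 0 <= a i) -> fsummable a ->
  (\esum_(i in [set: I]) (a i)%:E < +oo)%E.
Proof. by move=> a0; rewrite /fsummable; under eq_esum do rewrite ger0_norm//.
  Qed.

Let max0 (x : R) : 0 <= Num.max x 0.
Proof. by rewrite le_max lexx orbT. Qed.

Let sfin a : (forall i, 0 <= a i) -> fsummable a ->
  (\esum_(i in [set: I]) (a i)%:E)%E \is a fin_num.
Proof.
move=> a0 /(sge0 a0) sa; rewrite ge0_fin_numE// esum_ge0// => i _.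
by rewrite lee_fin.
Qed.

Lemma fsum_fin a : fsummable a -> fsum a \is a fin_num.
Proof.
by move=> sa; rewrite fsumE// fin_numB !sfin//; [exact: sneg|exact: spos].
Qed.

Lemma fsumD a b : fsummable a -> fsummable b ->
  fsum (fun i => a i + b i) = (fsum a + fsum b)%E.
Proof.
move=> sa sb.
(* The regrouping is not the decomposition of a + b into its positive and negative parts, but
   [fsumB] accepts it. *)
have -> : (fun i => a i + b i) = (fun i =>
    (Num.max (a i) 0 + Num.max (b i) 0) - (Num.max (- a i) 0 +
      Num.max (- b i) 0)).
  by apply/funext => i; rewrite {1}(posE a i) {1}(posE b i); lra.
have [sa1 sa2 sb1 sb2] := And4 (spos sa) (sneg sa) (spos sb) (sneg sb).
rewrite fsumB; last 4 first.
- by apply: sge0; [move=> i; rewrite addr_ge0|exact: fsummableD].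
- by apply: sge0; [move=> i; rewrite addr_ge0|exact: fsummableD].
- by move=> i; rewrite addr_ge0.
- by move=> i; rewrite addr_ge0.
under eq_esum do rewrite EFinD.
under [X in (_ - X)%E]eq_esum do rewrite EFinD.
rewrite !esumD; try by move=> i _; rewrite lee_fin.
rewrite !fsumE// oppeD; last by rewrite fin_num_adde_defr// sfin.
by rewrite addeACA.
Qed.

Lemma fsumN a : fsummable a -> fsum (fun i => - a i) = (- fsum a)%E.
Proof.
move=> sa; have sNa : fsummable (fun i => - a i).
  by apply: fsummable_le sa => i; rewrite normrN.
rewrite !fsumE//; under [X in (_ - X)%E]eq_esum do rewrite opprK.
by rewrite fin_num_oppeB 1?addeC// sfin//; exact: sneg.
Qed.

Lemma le_abs_fsum a : (`|fsum a| <= \esum_(i in [set: I]) (`|a i|)%:E)%E.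
Proof.
have [sa|] := boolP (\esum_(i in [set: I]) (`|a i|)%:E < +oo)%E; last first.
  by rewrite -leNgt leye_eq => /eqP ->; rewrite leey.
rewrite fsumE//; apply: le_trans (lee_abs_sub _ _) _.
rewrite !gee0_abs; try by apply: esum_ge0 => i _; rewrite lee_fin.
rewrite -esumD; try by move=> i _; rewrite lee_fin.
apply: le_esum => i _; rewrite -EFinD lee_fin.
by case: (ger0P (a i)) => ai; case: (leP (a i) 0) => ai'; case:
  (leP (- a i) 0) => nai; lra.
Qed.

Lemma fsumZ c a : fsummable a -> fsum (fun i => c * a i) = (c%:E * fsum a)%E.
Proof.
move=> sa; wlog c0 : c / 0 <= c.
  move=> H; have [/H //|c0] := leP 0 c.
  have -> : (fun i => c * a i) = (fun i => - (- c * a i)).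
    by apply/funext => i; rewrite mulNr opprK.
  rewrite fsumN; last first.
    rewrite /fsummable; under eq_esum do rewrite normrM EFinM.
    by rewrite esumZl// lte_mul_pinfty.
  by rewrite H ?oppr_ge0 1?ltW// EFinN mulNe oppeK.
have max0M x : Num.max (c * x) 0 = c * Num.max x 0 by rewrite -{1}(mulr0 c)
  maxr_pMr.
rewrite !fsumE.
under eq_esum do rewrite max0M EFinM.
under [X in (_ - X)%E]eq_esum do rewrite -mulrN max0M EFinM.
rewrite !esumZl ?muleBr//; try by move=> i; rewrite lee_fin.
by rewrite fin_num_adde_defl// fin_numN; apply: sfin => //; exact: sneg.
Qed.

Lemma fsum_reindex (e : I -> I) a : bijective e ->
  fsum (fun i => a (e i)) = fsum a.
Proof.
move=> be; rewrite /fsum.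
have he : set_bij [set: I] [set: I] e by rewrite setTT_bijective.
congr (_ - _)%E.
- rewrite [RHS](reindex_esum _ _ _ _ he).
  by apply: eq_esum => i _; rewrite !funeposE.
- rewrite [RHS](reindex_esum _ _ _ _ he).
  by apply: eq_esum => i _; rewrite !funenegE.
Qed.

End fsum.

(** * Domination of the kernel by its levels *)

Lemma ge_ellnorm (R : realType) d (kappa : \bar R) (x : 'rV[R]_d) k :
  (1 <= kappa)%E -> `|x 0 k| <= ellnorm kappa x.
Proof.
case: kappa => [r| |]; rewrite ?lee_fin //= => r1; last exact: le_bigmax_cond.
have r0 : 0 < r by exact: lt_le_trans r1.
rewrite -{1}(powRr1 (normr_ge0 (x 0 k))) -{1}(mulfV (lt0r_neq0 r0)) powRrM.
apply: ge0_ler_powR; rewrite ?invr_ge0 ?nnegrE ?powR_ge0 ?(ltW r0)//.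
  by apply: sumr_ge0 => i _; exact: powR_ge0.
rewrite (bigD1 k)//= lerDl; apply: sumr_ge0 => i _; exact: powR_ge0.
Qed.

Lemma ge0_series_le_lim (R : realType) (u : nat -> R) N :
  (forall n, 0 <= u n) ->
  cvgn (series u) -> \sum_(0 <= n < N) u n <= limn (series u).
Proof.
move=> u0 cu; apply: (nondecreasing_cvgn_le _ cu N).
by apply: nondecreasing_series => n _ _.
Qed.

(* Since rho is bounded, m^(2d) theta(m) / rho(m) dominates (m+1)^d theta(m) up
   to a constant, except at m = 0 where it vanishes. *)
Lemma dgood_sum_bound (R : realType) d (theta : R -> R) : (0 < d)%N ->
  dgood d theta -> exists2 C, 0 < C & forall N,
  \sum_(0 <= m < N) theta m%:R * m.+1%:R ^+ d <= C.
Proof.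
move=> d0 [th0 thd [rho [rho0 crho cser]]].
set u := (fun m => _) in cser.
have thm0 (m : nat) : 0 <= theta m%:R by exact: th0.
have u0 m : 0 <= u m.
  by rewrite /u !mulr_ge0 ?exprn_ge0// invr_ge0 ltW.
pose B := limn (series rho).
have rhoB m : rho m <= B.
  apply: le_trans (ge0_series_le_lim m.+1 (fun n => ltW (rho0 n)) crho).
  by rewrite big_nat_recr//= lerDr sumr_ge0// => i _; exact: ltW.
have B0 : 0 < B by exact: lt_le_trans (rho0 0%N) (rhoB _).
pose U := limn (series u).
have U0 : 0 <= U by have := ge0_series_le_lim 0 u0 cser; rewrite big_geq.
exists (theta 0 + 2 ^+ d * B * U + 1).
  by rewrite ltr_wpDl// addr_ge0 ?th0// !mulr_ge0 ?exprn_ge0// ltW.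
have term m : theta m.+1%:R * m.+2%:R ^+ d <= 2 ^+ d * B * u m.+1.
  rewrite /u.
  have -> : 2 ^+ d * B * (m.+1%:R ^+ (2 * d) * theta m.+1%:R / rho m.+1) =
     theta m.+1%:R * (2 ^+ d * m.+1%:R ^+ (2 * d)) * (B / rho m.+1) by lra.
  rewrite -mulrA ler_wpM2l// -[leLHS]mulr1 ler_pM ?exprn_ge0//; last first.
    by rewrite ler_pdivlMr// mul1r.
  rewrite exprM -exprMn -[_ ^+ 2]natrX -natrM -!natrX ler_nat.
  by apply: leq_expr; rewrite -mulnn; nia.
case=> [|N]; first by rewrite big_geq// !addr_ge0 ?th0// !mulr_ge0
  ?exprn_ge0// ltW.
rewrite big_nat_recl//= expr1n mulr1 -!addrA lerD2l -[leLHS]addr0 lerD//.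
apply: (@le_trans _ _ (\sum_(0 <= i < N) 2 ^+ d * B * u i.+1)).
  by apply: ler_sum => i _; exact: term.
rewrite -mulr_sumr ler_wpM2l ?mulr_ge0 ?exprn_ge0 ?(ltW B0)//.
apply: le_trans (ge0_series_le_lim N.+1 u0 cser).
by rewrite [leRHS]big_nat_recl//= lerDr.
Qed.

Definition znorm {d} (j : 'rV[int]_d) : nat := \max_(k < d) absz (j 0%R k).

Lemma zballE d N (j : 'rV[int]_d) : zball N j <-> (znorm j <= N)%N.
Proof.
split=> [jN|/bigmax_leqP jN k]; first by apply/bigmax_leqP => k _; exact: jN.
exact: jN.
Qed.

(* The maximal function of a at 0 is at most lam, with normalization N^d rather
   than the number (2N+1)^d of points of the cube. *)
Definition cube_bounded (R : realType) d (a : 'rV[int]_d -> R) (lam : R) :=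
  forall N, (0 < N)%N ->
    (\esum_(j in zball N) (`|a j|)%:E <= (lam * N%:R ^+ d)%:E)%E.

Section kernel.
Context (R : realType) (d : nat) (hd : (0 < d)%N) (kappa : \bar R)
  (hkappa : (1 <= kappa)%E) (psi : 'rV[R]_d -> R) (theta : R -> R)
  (theta_good : dgood d theta)
  (psi_theta : forall x, `|psi x| <= theta (ellnorm kappa x)).

(** The l^kappa-norm dominates the sup norm, which dominates its integer part; as [theta] is
    non-increasing, each replacement only enlarges the bound. It then depends on j through its level
    alone. *)
Lemma psi_scaled_le n j : (0 < n)%N ->
  `|psi (scaled R n j)| <= theta (znorm j %/ n)%N%:R.
Proof.
move=> n0; apply: le_trans (psi_theta _) _; case: theta_good => _ + _;
  apply => //.
(* The maximum is attained because d > 0. *)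
have [k kE] : exists k, znorm j = absz (j 0%R k).
  have [|k kE] := @bigop.eq_bigmax 'I_d (fun k => absz (j 0%R k));
    first by rewrite card_ord.
  by exists k; rewrite -kE.
apply: le_trans (ge_ellnorm (scaled R n j) k hkappa).
rewrite !mxE normrM ger0_norm ?invr_ge0// -intr_norm mulrC ler_pdivlMr ?ltr0n//.
rewrite -abszE -natrM; rewrite (_ : _%:~R = (absz (j 0%R k))%:R :> R)//
  ler_nat -kE.
exact: leq_divM.
Qed.

(** The level m lies in the cube of radius (m + 1) n, whose cube bound lam ((m + 1) n)^d supplies
    the weight (m + 1)^d. *)
Lemma esum_level_le a lam n m : (0 < n)%N -> cube_bounded a lam ->
  (\esum_(j in [set j | (znorm j %/ n)%N = m])
     (`|psi (scaled R n j)| * `|a j|)%:E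
   <= (theta m%:R * m.+1%:R ^+ d * (lam * n%:R ^+ d))%:E)%E.
Proof.
move=> n0 alam; have th0 : 0 <= theta m%:R by case: theta_good => + _ _; apply.
apply: (@le_trans _ _ ((theta m%:R)%:E *
    \esum_(j in [set j | (znorm j %/ n)%N = m]) (`|a j|)%:E)%E).
  rewrite -esumZl//; apply: le_esum => j /= <-.
  by rewrite -EFinM lee_fin ler_wpM2r// psi_scaled_le.
rewrite -mulrA EFinM lee_wpmul2l//.
apply: le_trans (_ : _ <= \esum_(j in zball (m.+1 * n)) (`|a j|)%:E)%E _.
  apply: le_esum_subset => // j /= jm; apply/zballE.
  by rewrite -jm ltnW// ltn_ceil.
apply: le_trans (alam _ _) _; first by rewrite muln_gt0.
by rewrite lee_fin natrM exprMn; lra.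
Qed.

Context (C : R)
  (HC : forall N, \sum_(0 <= m < N) theta m%:R * m.+1%:R ^+ d <= C).

Lemma kernel_domination a lam n : (0 < n)%N -> 0 <= lam -> cube_bounded a lam ->
  (\esum_(j in [set: 'rV[int]_d]) (`|psi (scaled R n j) * a j|)%:E
    <= (C * lam * n%:R ^+ d)%:E)%E.
Proof.
move=> n0 lam0 alam.
have -> : [set: 'rV[int]_d] = \bigcup_m [set j | (znorm j %/ n)%N = m].
  by rewrite eqEsubset; split=> j //= _; exists (znorm j %/ n)%N.
rewrite esum_bigcupT//; last by move=> i j _ _ [x [/= <- <-]].
rewrite -nneseries_esumT; last by move=> m; exact: esum_ge0.
apply: lime_le; first by apply: is_cvg_nneseries => m _ _; exact: esum_ge0.
apply: nearW => N.
apply: (@le_trans _ _ (\sum_(0 <= m < N)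
   (theta m%:R * m.+1%:R ^+ d * (lam * n%:R ^+ d))%:E)%E).
  apply: lee_sum => m _; under eq_esum do rewrite normrM.
  exact: esum_level_le.
by rewrite sumEFin lee_fin -mulr_suml -mulrA ler_wpM2r ?mulr_ge0 ?exprn_ge0.
Qed.

End kernel.

Lemma esum_zball_cst (R : realType) d (H : R) N : 0 <= H ->
  (\esum_(j in @zball d N) H%:E = (H * (N.*2.+1)%:R ^+ d)%:E)%E.
Proof.
move=> H0; pose x : {ffun 'I_d -> 'I_N.*2.+1} := [ffun=> inord N].
have xN k : x k = N :> nat by rewrite ffunE inordK// ltnS -addnn leq_addr.
rewrite (@zball_cube d N.*2.+1 N N x)//; last first.
  by move=> k; rewrite xN leqnn -addnn ltnSn.
rewrite (@esum_fin_image _ _ _ _ _ (fun=> H))//; last first.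
  by move=> y z /addIr /cube_pt_inj.
congr (_%:E); rewrite (eq_bigl xpredT) => [|y].
  rewrite sumr_const card_ffun !card_ord -natrX mulr_natr.
  by [].
rewrite /= cube_dist_le; apply/forallP => k; rewrite xN.
by rewrite leq_addl andbT addnn -ltnS ltn_ord.
Qed.

(** The cube of radius N has (2N + 1)^d <= (3N)^d points for N >= 1. *)
Lemma cube_bounded_cst (R : realType) d (a : 'rV[int]_d -> R) H : 0 <= H ->
  (forall j, `|a j| <= H) -> cube_bounded a (3 ^+ d * H).
Proof.
move=> H0 aH N N0.
apply: (@le_trans _ _ (\esum_(j in @zball d N) H%:E)%E).
  by apply: le_esum => j _; rewrite lee_fin.
rewrite esum_zball_cst// lee_fin [leRHS]mulrAC [leRHS]mulrC ler_wpM2l//.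
by rewrite -exprMn -natrM -!natrX ler_nat; apply: leq_expr; rewrite -mul2n; lia.
Qed.

Lemma cube_boundedD (R : realType) d (a b : 'rV[int]_d -> R) lam mu :
  cube_bounded a lam -> cube_bounded b mu ->
  cube_bounded (fun j => a j + b j) (lam + mu).
Proof.
move=> alam bmu N N0; rewrite mulrDl EFinD; apply: le_trans (leeD (alam _ N0)
  (bmu _ N0)).
rewrite -esumD//.
by apply: le_esum => j _; rewrite -EFinD lee_fin ler_normD.
Qed.

(** * Kernel averages along one orbit *)

Section kernel_average.
Context (R : realType) (d : nat) (hd : (0 < d)%N) (kappa : \bar R)
  (hkappa : (1 <= kappa)%E) (psi : 'rV[R]_d -> R) (theta : R -> R)
  (theta_good : dgood d theta)
  (psi_theta : forall x, `|psi x| <= theta (ellnorm kappa x)).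
Context (C : R)
  (HC : forall N, \sum_(0 <= m < N) theta m%:R * m.+1%:R ^+ d <= C).

(** The average of a family on Z^d; for b j = f (T^j w) it unfolds to [ergodic_sum] at w. Nothing in
    this section refers to a probability. *)
Definition kavg n (b : 'rV[int]_d -> R) : \bar R :=
  normalized_sum n (fun j => psi (scaled R n j) * b j).

Lemma kavg_summable n b lam : (0 < n)%N -> 0 <= lam -> cube_bounded b lam ->
  fsummable (fun j => psi (scaled R n j) * b j).
Proof.
move=> n0 lam0 blam.
have := kernel_domination hd hkappa theta_good psi_theta HC n0 lam0 blam.
by move=> /le_lt_trans; apply; exact: ltry.
Qed.

Lemma kavg_fin n b lam : (0 < n)%N -> 0 <= lam -> cube_bounded b lam ->
  kavg n b \is a fin_num.
Proof.
by move=> n0 lam0 /(kavg_summable n0 lam0) s; rewrite fin_numM// fsum_fin.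
Qed.

Lemma norm_kavg_le n b : (0 < n)%N ->
  (`|kavg n b| <= (n%:R ^+ d)^-1%:E *
     \esum_(j in [set: 'rV[int]_d]) (`|psi (scaled R n j) * b j|)%:E)%E.
Proof.
move=> n0; rewrite /kavg /normalized_sum abseM gee0_abs ?lee_fin ?invr_ge0
  ?exprn_ge0//.
by apply: lee_wpmul2l; [rewrite lee_fin invr_ge0 exprn_ge0|exact: le_abs_fsum].
Qed.

Lemma kavg_le n b lam : (0 < n)%N -> 0 <= lam -> cube_bounded b lam ->
  (`|kavg n b| <= (C * lam)%:E)%E.
Proof.
move=> n0 lam0 blam; apply: le_trans (norm_kavg_le b n0) _.
have np : 0 < n%:R ^+ d :> R by rewrite exprn_gt0// ltr0n.
rewrite (_ : C * lam = (n%:R ^+ d)^-1 * (C * lam * n%:R ^+ d)); last first.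
  by rewrite [RHS]mulrC mulfK// gt_eqF.
rewrite EFinM; apply: lee_wpmul2l; first by rewrite lee_fin invr_ge0 ltW.
exact: (kernel_domination hd hkappa theta_good psi_theta HC n0 lam0 blam).
Qed.

Lemma kavgD n a b lam mu : (0 < n)%N -> 0 <= lam -> 0 <= mu ->
  cube_bounded a lam -> cube_bounded b mu ->
  kavg n (fun j => a j + b j) = (kavg n a + kavg n b)%E.
Proof.
move=> n0 lam0 mu0 alam bmu; rewrite /kavg /normalized_sum.
have sa := kavg_summable n0 lam0 alam; have sb := kavg_summable n0 mu0 bmu.
rewrite -muleDr//; last by rewrite fin_num_adde_defr// fsum_fin.
congr (_ * _)%E; rewrite -fsumD//; congr fsum; apply/funext => j.
by rewrite mulrDr.
Qed.

Lemma kavg_cst n (g : R) : (0 < n)%N ->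
  kavg n (fun=> g) = (g%:E * normalized_sum n (fun j => psi (scaled R n j)))%E.
Proof.
move=> n0; have s1 : fsummable (fun j => psi (scaled R n j)).
  have b1 := @cube_bounded_cst R d (fun=> 1) 1 ler01 (fun=>
    ltac:(by rewrite normr1)).
  have := kavg_summable n0 _ b1; rewrite mulr1 exprn_ge0// => /(_ isT).
  by congr fsummable; apply/funext => j; rewrite mulr1.
rewrite /kavg /normalized_sum [RHS]muleCA; congr (_ * _)%E.
rewrite -fsumZ//; congr fsum.
by apply/funext => j; rewrite mulrC.
Qed.

(** Summation by parts: reindexing by j -> j + e_i moves the difference from b to psi, and the
    result is at most H times the quantity that tends to 0 by assumption. *)
Lemma kavg_coboundary (b : 'rV[int]_d -> R) (H : R) (i : 'I_d) : 0 <= H ->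
  (forall j, `|b j| <= H) ->
  normalized_sum n (fun j : 'rV[int]_d =>
      `|psi (scaled R n j) - psi (scaled R n (j + delta_mx 0 i))|)
    @[n --> \oo] --> 0%E ->
  kavg n (fun j => b j - b (j + delta_mx 0 i)) @[n --> \oo] --> 0%E.
Proof.
move=> H0 bH psi0; pose e : 'rV[int]_d := delta_mx 0 i.
apply/cvg_abse0P.
have : (H%:E * normalized_sum n (fun j : 'rV[int]_d =>
      `|psi (scaled R n j) - psi (scaled R n (j + delta_mx 0 i))|%R))%E
    @[n --> \oo] --> 0%E.
  by rewrite -(mule0 H%:E); exact: cvgeZl.
apply: (squeeze_cvge _ (cvg_cst 0%E)).
exists 1%N => // n /= n0; rewrite abse_ge0 /=.
have H3 : 0 <= 3 ^+ d * H by rewrite mulr_ge0// exprn_ge0.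
have bb := cube_bounded_cst H0 bH.
have bbe : cube_bounded (fun j => b (j + e)) (3 ^+ d * H).
  by apply: cube_bounded_cst.
have sb := kavg_summable n0 H3 bb; have sbe := kavg_summable n0 H3 bbe.
have be : bijective (fun j : 'rV[int]_d => j + e).
  by exists (fun j => j - e) => j; rewrite ?addrK ?subrK.
have sbe' : fsummable (fun j => psi (scaled R n (j + e)) * b (j + e)).
  move: sb; rewrite /fsummable (reindex_esum [set: 'rV[int]_d] _ (fun j =>
    j + e))//.
  by rewrite setTT_bijective.
have sNbe : fsummable (fun j => - (psi (scaled R n j) * b (j + e))).
  by apply: fsummable_le sbe => j; rewrite normrN.
rewrite /kavg (_ : normalized_sum _ _ = ((n%:R ^+ d)^-1%:E * fsum (fun j :
  'rV[int]_d =>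
    (- (psi (scaled R n j) - psi (scaled R n (j + e))) * b (j + e))%R))%E);
      last first.
  rewrite /normalized_sum; congr (_ * _)%E.
  transitivity (fsum (fun j => psi (scaled R n j) * b j +
    - (psi (scaled R n j) * b (j + e)))).
    by congr fsum; apply/funext => j; rewrite mulrBr.
  rewrite fsumD// -(fsum_reindex _ be) -fsumD//.
  by congr fsum; apply/funext => j /=; ring.
rewrite abseM gee0_abs ?lee_fin ?invr_ge0 ?exprn_ge0// /normalized_sum muleCA.
apply: lee_wpmul2l; first by rewrite lee_fin invr_ge0 exprn_ge0.
apply: le_trans (le_abs_fsum _) _; rewrite fsum_ge0// -esumZl//.
by apply: le_esum => j _; rewrite -EFinM lee_fin normrM normrN mulrC ler_wpM2r.
Qed.

(** The cube bound is kept along with the limit because it provides the summability that [kavgD]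
    requires. *)
Definition kavg_null (b : 'rV[int]_d -> R) :=
  (exists2 lam, 0 <= lam & cube_bounded b lam) /\ kavg n b @[n --> \oo] --> 0%E.

Lemma kavg_null0 : kavg_null (fun=> 0).
Proof.
split.
  exists 0 => //.
  have := @cube_bounded_cst R d (fun=> 0) 0 (lexx _)
    (fun=> ltac:(by rewrite normr0)).
  by rewrite mulr0.
apply: cvg_near_cst; exists 1%N => // n /= n0.
by rewrite kavg_cst// mul0e.
Qed.

Lemma kavg_nullD a b : kavg_null a -> kavg_null b ->
  kavg_null (fun j => a j + b j).
Proof.
move=> [[lam lam0 alam] a0] [[mu mu0 bmu] b0]; split.
  by exists (lam + mu); [exact: addr_ge0|exact: cube_boundedD].
have : (kavg n a + kavg n b)%E @[n --> \oo] --> 0%E.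
  by rewrite -[X in _ --> X](adde0 0%E); exact: cvgeD.
apply: cvg_trans; apply: near_eq_cvg.
by exists 1%N => // n /= n0; rewrite (kavgD n0 lam0 mu0).
Qed.

Context (c : R) (hpsi3 : normalized_sum n (fun j : 'rV[int]_d =>
  psi (scaled R n j))
    @[n --> \oo] --> c%:E).

(** The constant g contributes c g and z contributes 0, both in the limit, which costs eps; r
    contributes at most C lam for each n >= 1, although its averages need not converge. *)
Lemma kavg_near (g : R) (z r : 'rV[int]_d -> R) (lam eps : R) : kavg_null z ->
  0 <= lam ->
  cube_bounded r lam -> 0 < eps ->
  \forall n \near \oo,
    (`|kavg n (fun j => (g + z j + r j)%R) - (c * g)%:E| <=
      (C * lam + eps)%:E)%E.
Proof.
move=> [[mu mu0 zmu] z0] lam0 rlam eps0.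
have gb := @cube_bounded_cst R d (fun=> g) `|g| (normr_ge0 _) (fun=> lexx _).
have g0 : 0 <= 3 ^+ d * `|g| by rewrite mulr_ge0// exprn_ge0.
have lim : (kavg n (fun=> g) + kavg n z)%E @[n --> \oo] --> (c * g)%:E.
  rewrite -[X in _ --> X]adde0; apply: cvgeD => //.
  have : (g%:E * normalized_sum n (fun j => psi (scaled R n j)))%E @[n -->
    \oo] --> (c * g)%:E.
    by rewrite mulrC EFinM; exact: cvgeZl.
  apply: cvg_trans; apply: near_eq_cvg.
  by exists 1%N => // n /= n0; rewrite kavg_cst.
have /fine_cvgP[limfin /cvgrPdist_le /(_ _ eps0) limd] := lim.
near=> n.
have n0 : (0 < n)%N by near: n; exists 1%N.
have bgz := cube_boundedD gb zmu.
rewrite (kavgD n0 _ lam0 bgz rlam) ?addr_ge0// (kavgD n0 g0 mu0 gb zmu).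
have ufin : (kavg n (fun=> g) + kavg n z)%E \is a fin_num by near: n;
  exact: limfin.
have ud : `|c * g - fine (kavg n (fun=> g) + kavg n z)%E| <= eps.
  by near: n; exact: limd.
rewrite addeAC; apply: le_trans (lee_abs_add _ _) _; rewrite addeC EFinD leeD//.
  exact: kavg_le.
by rewrite -(fineK ufin) -EFinB lee_fin distrC.
Unshelve. all: by end_near. Qed.

End kernel_average.

(** * Birkhoff theorem for bounded functions *)

Section limn_sup_bounded.
Context (R : realType).
Implicit Types u v : R^nat.

Lemma bounded_funE u H : (forall n, `|u n| <= H) -> bounded_fun (u : R^o^nat).
Proof.
move=> uH; exists H; split; first exact: num_real.
by move=> M HM n _; apply: le_trans (uH n) (ltW HM).
Qed.

Lemma limn_sup_gt u H eps N : (forall n, `|u n| <= H) -> 0 < eps ->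
  exists2 n, (N <= n)%N & limn_sup u - eps < u n.
Proof.
move=> uH eps0; have bu := bounded_funE uH.
have sN : limn_sup u <= sups u N.
  rewrite limn_supE//; apply: ge_inf; last by exists N.
  exact: bounded_fun_has_lbound_sups.
have : limn_sup u - eps < sups u N by lra.
have hs : has_sup (sdrop u N).
  by split; [exists (u N); exists N => /=|
    exact/has_ubound_sdrop/bounded_fun_has_ubound].
by move=> /(sup_gt hs.1) [_ [n /= Nn <-] un]; exists n.
Qed.

Lemma limn_sup_lt u H eps : (forall n, `|u n| <= H) -> 0 < eps ->
  \forall n \near \oo, u n < limn_sup u + eps.
Proof.
move=> uH eps0; have bu := bounded_funE uH.
have : inf (range (sups u)) < limn_sup u + eps by rewrite -limn_supE//; lra.
move=> /(inf_lt (ex_intro _ _ (ex_intro2 _ _ 0%N I erefl))) [_ [N _ <-] hN].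
exists N => // n /= Nn; apply: le_lt_trans hN; apply: ub_le_sup;
  last by exists n.
exact/has_ubound_sdrop/bounded_fun_has_ubound.
Qed.

Lemma norm_limn_sup_le u H : (forall n, `|u n| <= H) -> `|limn_sup u| <= H.
Proof.
move=> uH; rewrite ler_norml; apply/andP; split; apply/ler_addgt0Pr => e e0.
  have [N _ /(_ N (leqnn _)) /= hN] := limn_sup_lt uH e0.
  by have := uH N; rewrite ler_norml => /andP[]; lra.
have [n _ hn] := limn_sup_gt 0 uH e0.
by have := uH n; rewrite ler_norml => /andP[]; lra.
Qed.

Lemma limn_sup_eq u v H K : (forall n, `|u n| <= H) ->
  (forall n, `|v n| <= K) ->
  (v n - u n) @[n --> \oo] --> 0 -> limn_sup u = limn_sup v.
Proof.
move=> uH vK vu; apply/eqP; rewrite eq_le.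
suff h (a b : R^nat) A B : (forall n, `|a n| <= A) -> (forall n, `|b n| <= B) ->
   (b n - a n) @[n --> \oo] --> 0 -> limn_sup b <= limn_sup a.
  rewrite (h _ _ _ _ uH vK vu) andbT (h _ _ _ _ vK uH)//.
  by rewrite -oppr0; under eq_cvg do rewrite -opprB; exact: cvgN.
move=> aA bB ab; apply/ler_addgt0Pr => e e0.
have e20 : 0 < e / 3 by lra.
have [N1 _ h1] := limn_sup_lt aA e20.
have /cvgrPdist_lt /(_ _ e20) [N2 _ h2] := ab.
have [n Nn hn] := limn_sup_gt (maxn N1 N2) bB e20.
have /= := h1 n (leq_trans (leq_maxl _ _) Nn).
have /= := h2 n (leq_trans (leq_maxr _ _) Nn).
by rewrite sub0r normrN ltr_norml => /andP[]; lra.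
Qed.

(** The left side is the limit inferior of u; in this form, facts about limits superior serve for
    both. *)
Lemma limn_supN_ge u H : (forall n, `|u n| <= H) ->
  - limn_sup (fun n => - u n) <= limn_sup u.
Proof.
move=> uH; apply/ler_addgt0Pr => e e0; have e20 : 0 < e / 2 by lra.
have uH' n : `|- u n| <= H by rewrite normrN.
have [N1 _ h1] := limn_sup_lt uH e20; have [N2 _ h2] := limn_sup_lt uH' e20.
have := h1 (maxn N1 N2) (leq_maxl _ _); have := h2 (maxn N1 N2) (leq_maxr _ _).
by move=> /=; lra.
Qed.

Lemma limn_supN_cvg u H : (forall n, `|u n| <= H) ->
  - limn_sup (fun n => - u n) = limn_sup u -> u n @[n --> \oo] --> limn_sup u.
Proof.
move=> uH e; apply/cvgrPdist_lt => eps eps0.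
have uH' n : `|- u n| <= H by rewrite normrN.
have [N1 _ h1] := limn_sup_lt uH eps0; have [N2 _ h2] := limn_sup_lt uH' eps0.
exists (maxn N1 N2) => // n /= Nn.
have := h1 n (leq_trans (leq_maxl _ _) Nn);
  have := h2 n (leq_trans (leq_maxr _ _) Nn).
by rewrite /= -e ltr_norml => h3 h4; apply/andP; split; lra.
Qed.

End limn_sup_bounded.

(** * Bounded measurable functions *)

Section bounded_measurable.
Context (R : realType) (disp : measure_display) (Om : measurableType disp)
  (P : probability Om R).
Implicit Types f g : Om -> R.

(** Bounded at every point and not only almost everywhere, so that sequences along each orbit are
    bounded without an exceptional set. *)
Definition bmeas f := measurable_fun [set: Om] f /\ exists H, forall w,
  `|f w| <= H.

Lemma bmeas_integrable f : bmeas f -> P.-integrable [set: Om] (EFin \o f).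
Proof.
move=> [mf [H fH]]; apply: measurable_bounded_integrable => //.
  by rewrite ltey_eq fin_num_measure.
exists H; split; first exact: num_real.
by move=> M HM n _; apply: le_trans (fH n) (ltW HM).
Qed.

Lemma bmeas_cst (k : R) : bmeas (fun=> k).
Proof. by split; [exact: measurable_cst|exists `|k|]. Qed.

Lemma bmeasD f g : bmeas f -> bmeas g -> bmeas (fun w => f w + g w).
Proof.
move=> [mf [H fH]] [mg [K gK]]; split; first exact: measurable_funD.
by exists (H + K) => w; apply: le_trans (ler_normD _ _) (lerD _ _).
Qed.

Lemma bmeasN f : bmeas f -> bmeas (fun w => - f w).
Proof.
move=> [mf [H fH]]; split; first exact: measurableT_comp.
by exists H => w; rewrite normrN.
Qed.

Lemma bmeasB f g : bmeas f -> bmeas g -> bmeas (fun w => f w - g w).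
Proof. by move=> bf /bmeasN; exact: bmeasD. Qed.

Lemma bmeasM f g : bmeas f -> bmeas g -> bmeas (fun w => f w * g w).
Proof.
move=> [mf [H fH]] [mg [K gK]]; split; first exact: measurable_funM.
exists (H * K) => w; rewrite normrM; apply: ler_pM => //.
Qed.

Lemma bmeas_norm f : bmeas f -> bmeas (fun w => `|f w|).
Proof.
move=> [mf [H fH]]; split; first exact: measurableT_comp.
by exists H => w; rewrite normr_id.
Qed.

Lemma bmeas_max f g : bmeas f -> bmeas g ->
  bmeas (fun w => Num.max (f w) (g w)).
Proof.
move=> [mf [H fH]] [mg [K gK]]; split; first exact: measurable_maxr.
exists (H + K) => w; have := fH w; have := gK w.
have := normr_ge0 (f w); have := normr_ge0 (g w).
by case: (leP (f w) (g w)); lra.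
Qed.

Lemma bmeas_indic (A : set Om) : measurable A -> bmeas (\1_A).
Proof.
move=> mA; split; first exact: measurable_indic.
by exists 1 => w; rewrite indicE; case: (_ \in _); rewrite ?normr1 ?normr0.
Qed.

Lemma bmeas_sum (I : Type) (s : seq I) (F : I -> Om -> R) :
  (forall i, bmeas (F i)) -> bmeas (fun w => \sum_(i <- s) F i w).
Proof.
move=> bF; elim: s => [|i s IH].
  by under eq_fun do rewrite big_nil; exact: bmeas_cst.
by under eq_fun do rewrite big_cons; exact: bmeasD.
Qed.

Lemma bmeas_comp S f : measure_preserving P S -> bmeas f -> bmeas (f \o S).
Proof.
move=> hS [mf [H fH]]; split; first exact: measurableT_comp hS.1.
by exists H => w; exact: fH.
Qed.

Lemma Rintegral_measure_preserving S f : measure_preserving P S ->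
  measurable_fun [set: Om] f -> \int[P]_w f (S w) = \int[P]_w f w.
Proof. by move=> hS mf; rewrite /Rintegral integral_measure_preserving. Qed.

Lemma bmeas_cvg_integral (u : nat -> Om -> R) f H :
  (forall n, measurable_fun [set: Om] (u n)) -> measurable_fun [set: Om] f ->
  (forall n w, `|u n w| <= H) -> {ae P, forall w, u n w @[n --> \oo] --> f w} ->
  (\int[P]_w `|u n w - f w| @[n --> \oo] --> 0) /\
  (\int[P]_w u n w @[n --> \oo] --> \int[P]_w f w).
Proof.
move=> mu mf uH uf.
have [|||||if_ h1 h2] := @dominated_convergence _ _ _ P setT measurableT
  (fun n => EFin \o u n) (EFin \o f) (cst H%:E).
- by move=> n; exact/measurable_EFinP.
- exact/measurable_EFinP.
- by apply: filterS uf => w uw _; apply: cvg_EFin => //; exact: nearW.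
- exact: finite_measure_integrable_cst.
- by apply: aeW => w n _; rewrite lee_fin.
- split; first exact: (fine_cvg (h1 : _ --> 0%:E)).
  apply: fine_cvg; rewrite fineK; first exact: h2.
  exact: integrable_fin_num if_.
Qed.

Lemma measurable_superlevel f a : measurable_fun [set: Om] f ->
  measurable [set w | a < f w].
Proof.
move=> mf; rewrite (_ : [set w | a < f w] = [set: Om] `&` f @^-1` `]a,
  +oo[%classic).
  exact: mf.
by rewrite setTI eqEsubset; split=> w /=; rewrite in_itv /= andbT.
Qed.

End bounded_measurable.

(** * Birkhoff averages of one transformation *)

Section birkhoff.
Context (R : realType) (disp : measure_display) (Om : measurableType disp)
  (P : probability Om R) (S : Om -> Om) (hS : measure_preserving P S).
Implicit Types f g : Om -> R.

(* The maximum over 0 <= k <= n of the Birkhoff sums of length k, in the recursive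
   form on which Garsia's argument rests. *)
Fixpoint hopf_max f n w : R :=
  if n is m.+1 then Num.max 0 (f w + hopf_max f m (S w)) else 0.

Lemma hopf_maxS f n w :
  hopf_max f n.+1 w = Num.max 0 (f w + hopf_max f n (S w)).
Proof. by []. Qed.

Lemma hopf_max_ge0 f n w : 0 <= hopf_max f n w.
Proof. by case: n => //= n; rewrite le_max lexx. Qed.

Lemma hopf_max_bmeas f n : bmeas f -> bmeas (hopf_max f n).
Proof.
move=> bf; elim: n => [|n IH] /=; first exact: bmeas_cst.
apply: bmeas_max; first exact: bmeas_cst.
by apply: bmeasD => //; exact: (bmeas_comp hS).
Qed.

Lemma hopf_max_le f n w : hopf_max f n w <= hopf_max f n.+1 w.
Proof.
elim: n w => [|n IH] w; first by rewrite hopf_max_ge0.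
by rewrite hopf_maxS [leRHS]hopf_maxS ge_max !le_max lexx /= lerD2l IH orbT.
Qed.

Lemma hopf_max_ge_sum f n w : \sum_(0 <= i < n) f (iter i S w) <=
  hopf_max f n w.
Proof.
elim: n w => [|n IH] w; first by rewrite big_geq.
rewrite big_nat_recl//= le_max lerD2l; apply/orP; right.
by apply: le_trans (IH (S w)); under eq_bigr do rewrite -iterS iterSr.
Qed.

(** Write M_n for [hopf_max f n]. Where M_(n+1) > 0 it equals f + M_n o S, and elsewhere it is 0;
    hence f times the indicator of {M_(n+1) > 0} is at least M_(n+1) - M_n o S. By invariance of P
    the latter has integral that of M_(n+1) - M_n, which is nonnegative. By hypothesis the sets {M_n
    > 0} exhaust the space, and bounded convergence concludes. *)
Lemma hopf f : bmeas f -> (forall w, exists n, 0 < hopf_max f n w) ->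
  0 <= \int[P]_w f w.
Proof.
move=> bf fpos.
pose E n := [set w | 0 < hopf_max f n w].
have mE n : measurable (E n).
  exact: measurable_superlevel (hopf_max_bmeas n bf).1.
have b1 n : bmeas (\1_(E n) : Om -> R) by exact: bmeas_indic.
have bm n := hopf_max_bmeas n bf.
have bmS n : bmeas (fun w => hopf_max f n (S w)) by exact:
  (bmeas_comp hS (bm n)).
have I0 n : 0 <= \int[P]_w (f w * \1_(E n.+1) w).
  apply: (@le_trans _ _ (\int[P]_w (hopf_max f n.+1 w - hopf_max f n (S w)))).
    rewrite RintegralB//; [|exact: bmeas_integrable..].
    rewrite (Rintegral_measure_preserving hS (bm n).1) subr_ge0.
    apply: le_Rintegral => // [||w _]; [exact: bmeas_integrable..|].
    exact: hopf_max_le.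
  apply: le_Rintegral => //.
  - by apply: bmeas_integrable; exact: bmeasB.
  - by apply: bmeas_integrable; exact: bmeasM.
  - move=> w _; rewrite indicE; have := hopf_max_ge0 f n (S w).
    have [wE|wE] := boolP (w \in E n.+1).
      have : 0 < hopf_max f n.+1 w by move: wE; rewrite inE.
      by rewrite mulr1 /=; case: (leP 0 (f w + hopf_max f n (S w))); lra.
    have : ~ 0 < hopf_max f n.+1 w by move: wE; rewrite notin_setE.
    by move=> /negP; rewrite -leNgt mulr0; lra.
have [H fH] := bf.2.
have fE n w : `|f w * \1_(E n.+1) w| <= H.
  by rewrite indicE; case: (_ \in _); rewrite ?mulr1 ?mulr0 ?normr0//; exact:
    le_trans (fH w).
have mfE n : measurable_fun [set: Om] (fun w => f w * \1_(E n.+1) w).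
  exact: (bmeasM bf (b1 n.+1)).1.
have [|_ cv] := bmeas_cvg_integral (P := P) mfE bf.1 fE.
  apply: aeW => w; have [N wN] := fpos w.
  apply: cvg_near_cst; exists N => // n /= Nn.
  rewrite indicE mem_set ?mulr1//; apply: lt_le_trans wN _.
  by rewrite -(subnKC (leq_trans Nn (leqnSn n))); elim: (_ - _)%N => [|k IH];
    rewrite ?addn0// addnS; exact: le_trans IH (hopf_max_le _ _ _).
rewrite -(cvg_lim _ cv)//; apply: limr_ge; [exact: cvgP cv|exact: nearW].
Qed.

(** There are n + 1 terms, so the divisor never vanishes. *)
Definition birkhoff_avg f n w : R := (\sum_(0 <= i < n.+1) f (iter i S w)) /
  n.+1%:R.

Lemma measure_preserving_iter n : measure_preserving P (iter n S).
Proof.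
elim: n => [|n IH]; first exact: measure_preserving_id.
exact: (measure_preserving_comp hS IH).
Qed.

Lemma birkhoff_avg_bmeas f n : bmeas f -> bmeas (birkhoff_avg f n).
Proof.
move=> bf; apply: bmeasM; last exact: bmeas_cst.
by apply: bmeas_sum => i; exact: (bmeas_comp (measure_preserving_iter i) bf).
Qed.

Lemma birkhoff_avg_le f n w H : (forall w, `|f w| <= H) ->
  `|birkhoff_avg f n w| <= H.
Proof.
move=> fH; rewrite normrM [X in _ * X]ger0_norm ?invr_ge0// ler_pdivrMr
  ?ltr0n//.
apply: le_trans (ler_norm_sum _ _ _) _.
apply: le_trans (ler_sum _ (fun i _ => fH _)) _.
by rewrite sumr_const_nat subn0 mulr_natr.
Qed.

Lemma birkhoff_avgN f n w : birkhoff_avg (fun w => - f w) n w =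
  - birkhoff_avg f n w.
Proof. by rewrite /birkhoff_avg sumrN mulNr. Qed.

Lemma birkhoff_avg_shift f n w :
  birkhoff_avg f n (S w) - birkhoff_avg f n w = (f (iter n.+1 S w) - f w) /
    n.+1%:R.
Proof.
rewrite /birkhoff_avg -mulrBl; congr (_ / _).
rewrite [X in _ - X]big_nat_recl//= big_nat_recr//= -iterSr /=.
under eq_bigr do rewrite -iterSr.
by rewrite opprD addrACA [X in _ + X]addrC addrA addrAC; ring.
Qed.

(** A limit superior is available at every point before any convergence is known, and is invariant
    everywhere for bounded f. *)
Definition birkhoff_sup f w : R := limn_sup (fun n => birkhoff_avg f n w).

Lemma birkhoff_sup_bmeas f : bmeas f -> bmeas (birkhoff_sup f).
Proof.
move=> bf; have [H fH] := bf.2; have fnH n w := birkhoff_avg_le n w fH.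
split; last first.
  by exists H => w; apply: norm_limn_sup_le => n.
apply: measurable_fun_limn_sup => [w _|w _|n].
- by exists H => _ [n _ <-]; have := fnH n w; rewrite ler_norml => /andP[].
- by exists (- H) => _ [n _ <-]; have := fnH n w; rewrite ler_norml => /andP[].
- exact: (birkhoff_avg_bmeas n bf).1.
Qed.

(** The averages started at w and at S w differ by at most 2H / (n + 1). *)
Lemma birkhoff_sup_invariant f w : bmeas f -> birkhoff_sup f (S w) =
  birkhoff_sup f w.
Proof.
move=> bf; have [H fH] := bf.2; have fnH n w := birkhoff_avg_le n w fH.
apply/esym/(limn_sup_eq (fun n => fnH n w) (fun n => fnH n (S w))).
under eq_cvg do rewrite birkhoff_avg_shift.
have H2 : (H *+ 2) * n.+1%:R^-1 @[n --> \oo] --> 0.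
  rewrite -[X in _ --> X](mulr0 (H *+ 2)); apply: cvgM; first exact: cvg_cst.
  exact: cvg_harmonic.
have NH2 : - ((H *+ 2) * n.+1%:R^-1) @[n --> \oo] --> 0.
  by rewrite -oppr0; exact: cvgN.
apply: (squeeze_cvgr _ NH2 H2); apply: nearW => n.
rewrite -ler_norml normrM [X in _ * X]ger0_norm ?invr_ge0//.
rewrite ler_wpM2r ?invr_ge0//; apply: le_trans (ler_normB _ _) _.
by rewrite mulr2n lerD.
Qed.

(** When the commuting maps are treated one after the other, this preserves the invariances already
    gained. *)
Lemma birkhoff_sup_comm f U : (forall w, U (S w) = S (U w)) ->
  (forall w, f (U w) = f w) -> forall w, birkhoff_sup f (U w) =
    birkhoff_sup f w.
Proof.
move=> US fU w; congr limn_sup; apply/funext => n.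
congr (_ / _); apply: eq_bigr => i _.
suff -> : iter i S (U w) = U (iter i S w) by [].
by elim: i => //= i ->; rewrite US.
Qed.

(* Apply [hopf] to f - birkhoff_sup f + e, some Birkhoff sum of which is positive
   at every point because birkhoff_sup f is invariant. *)
Lemma Rintegral_birkhoff_sup_le f : bmeas f ->
  \int[P]_w birkhoff_sup f w <= \int[P]_w f w.
Proof.
move=> bf; apply/ler_addgt0Pr => e e0; have bs := birkhoff_sup_bmeas bf.
have [H fH] := bf.2.
have -> : \int[P]_w f w + e = \int[P]_w (f w + e).
  rewrite RintegralD//; [|exact: bmeas_integrable..|]; last first.
    exact: bmeas_integrable (bmeas_cst _ _).
  rewrite Rintegral_cst//; congr (_ + _).
  by rewrite -[LHS]mulr1; congr (_ * _);
    rewrite -[LHS](congr1 fine (probability_setT P)).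
have be : bmeas (fun w => f w + e) by apply: bmeasD => //; exact: bmeas_cst.
rewrite -subr_ge0 -RintegralB//; [|exact: bmeas_integrable..].
apply: hopf => [|w]; first exact: bmeasB.
have [n _ wn] := limn_sup_gt 0 (fun n => birkhoff_avg_le n w fH) e0.
exists n.+1; apply: lt_le_trans (hopf_max_ge_sum _ _ _).
have -> : \sum_(0 <= i < n.+1)
  (f (iter i S w) + e - birkhoff_sup f (iter i S w)) =
   n.+1%:R * (birkhoff_avg f n w + e - birkhoff_sup f w).
  have inv i : birkhoff_sup f (iter i S w) = birkhoff_sup f w.
    by elim: i => //= i IH; rewrite birkhoff_sup_invariant.
  under eq_bigr do rewrite inv -addrA.
  rewrite big_split/= sumr_const_nat subn0 -addrA mulrDr; congr (_ + _);
    last by rewrite mulr_natl.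
  by rewrite /birkhoff_avg [RHS]mulrC mulfVK// pnatr_eq0.
by rewrite mulr_gt0// subr_gt0 -ltrBlDr.
Qed.

(** The integral of the limit superior is at most that of f; applied to -f, this says that the
    integral of f is at most that of the limit inferior. Hence both limits agree a.s., the averages
    converge a.s., and bounded convergence gives L^1. *)
Lemma birkhoff f : bmeas f ->
  \int[P]_w `|birkhoff_avg f n w - birkhoff_sup f w| @[n --> \oo] --> 0.
Proof.
move=> bf; have [H fH] := bf.2.
have fnH n w := birkhoff_avg_le n w fH.
pose inff w := - birkhoff_sup (fun w => - f w) w.
have binf : bmeas inff by apply: bmeasN; apply: birkhoff_sup_bmeas;
  exact: bmeasN.
have bsup := birkhoff_sup_bmeas bf.
have infE w : inff w = - limn_sup (fun n => - birkhoff_avg f n w).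
  by congr (- limn_sup _); apply/funext => n; rewrite birkhoff_avgN.
have infsup w : inff w <= birkhoff_sup f w.
  by rewrite infE; exact: limn_supN_ge.
have Iinf : \int[P]_w f w <= \int[P]_w inff w.
  have := Rintegral_birkhoff_sup_le (bmeasN bf).
  have NI g : bmeas g -> \int[P]_w (- g w) = - \int[P]_w g w.
    move=> bg; under eq_Rintegral do rewrite -mulN1r.
    by rewrite RintegralZl// ?mulN1r//; exact: bmeas_integrable.
  by rewrite NI// NI; [lra|apply: birkhoff_sup_bmeas; exact: bmeasN].
have I0 : \int[P]_w (birkhoff_sup f w - inff w) = 0.
  apply/eqP; rewrite eq_le Rintegral_ge0 ?andbT; last by move=> w _;
    rewrite subr_ge0.
  rewrite RintegralB//; [|exact: bmeas_integrable..].
  by rewrite subr_le0; apply: le_trans Iinf; exact: Rintegral_birkhoff_sup_le.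
have ae0 : ae_eq P setT (EFin \o (fun w => birkhoff_sup f w - inff w))
  (cst 0%E).
  have bd := bmeasB bsup binf.
  apply/(ae_eq_integral_abs _ measurableT); first exact/measurable_EFinP/bd.1.
  have fin := integrable_fin_num measurableT (bmeas_integrable P bd).
  rewrite (eq_integral (EFin \o (fun w => birkhoff_sup f w - inff w)));
    last first.
    by move=> w _ /=; rewrite ger0_norm// subr_ge0.
  by rewrite -(fineK fin) -[fine _]/(\int[P]_w (birkhoff_sup f w - inff w)) I0.
have mavg n := (birkhoff_avg_bmeas n bf).1.
apply: (bmeas_cvg_integral mavg bsup.1 fnH _).1.
apply: filterS ae0 => w /(_ I) [] /eqP; rewrite subr_eq0 => /eqP e.
by apply: (limn_supN_cvg (fun n => fnH n w)); rewrite -infE -e.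
Qed.

End birkhoff.

(** * Almost sure convergence *)

Section decomposition.
Context (R : realType) (disp : measure_display) (Om : measurableType disp)
  (P : probability Om R) (d : nat) (T Tinv : 'I_d -> Om -> Om).
Context (hTK : forall i, cancel (T i) (Tinv i)).
Context (hTinvK : forall i, cancel (Tinv i) (T i)).
Context (hT : forall i, measure_preserving P (T i)).
Context (hTcomm : forall i k, T i \o T k = T k \o T i).

(** Finite sums of coboundaries of the different T_i with bounded transfer functions. The inductive
    form lets integrals and orbit averages be treated by induction. *)
Inductive coboundary : (Om -> R) -> Prop :=
| coboundary0 : coboundary (fun=> 0)
| coboundaryD f g : coboundary f -> coboundary g ->
    coboundary (fun w => f w + g w)
| coboundaryB i h : bmeas h -> coboundary (fun w => h w - h (T i w)).

Lemma coboundary_bmeas z : coboundary z -> bmeas z.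
Proof.
elim=> [|f g _ bf _ bg|i h bh]; first exact: bmeas_cst.
- exact: bmeasD.
- by apply: bmeasB => //; exact: (bmeas_comp (hT i) bh).
Qed.

(** For an invariant A, the function h o T_i cut off to A is the cut-off of h composed with T_i, so
    it has the same integral. *)
Lemma Rintegral_coboundary z A : coboundary z -> invariant_sets T A ->
  \int[P]_(w in A) z w = 0.
Proof.
move=> cz [mA TA].
have iA h : bmeas h -> P.-integrable A (EFin \o h).
  by move=> bh; apply: integrableS (bmeas_integrable P bh).
elim: cz => [|f g cf If cg Ig|i h bh].
- by rewrite Rintegral_cst// mul0r.
- rewrite RintegralD//; [by rewrite If Ig addr0|exact:
    iA (coboundary_bmeas cf)|].
  exact: iA (coboundary_bmeas cg).
- have bhT := bmeas_comp (hT i) bh.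
  rewrite RintegralB//; [|exact: iA|exact: iA].
  apply/eqP; rewrite subr_eq0; apply/eqP.
  rewrite [LHS]Rintegral_mkcond [RHS]Rintegral_mkcond.
  rewrite -[LHS](Rintegral_measure_preserving (hT i)); last first.
    by apply/measurable_restrict => //; rewrite ?setTI ?setIT; exact:
      measurable_funS bh.1.
  apply: eq_Rintegral => w _; rewrite /restrict.
  have TAw : A (T i w) = A w by rewrite -[in RHS](TA i).
  by have -> : (T i w \in A) = (w \in A) by apply/idP/idP; rewrite !inE TAw.
Qed.

(** Each f - f o T_i^k telescopes into h_k - h_k o T_i, where h_k is the sum of f o T_i^l over l <
    k; h is the mean of h_0, ..., h_n. *)
Lemma birkhoff_avg_coboundary i f n : bmeas f ->
  coboundary (fun w => f w - birkhoff_avg (T i) f n w).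
Proof.
move=> bf; pose h w : R :=
  (\sum_(0 <= k < n.+1) \sum_(0 <= l < k) f (iter l (T i) w)) / n.+1%:R.
have -> : (fun w => f w - birkhoff_avg (T i) f n w) = fun w => h w - h (T i w).
  apply/funext => w; rewrite /h /birkhoff_avg -mulrBl -sumrB.
  under [X in _ = X / _]eq_bigr => k _.
    rewrite -sumrB; under eq_bigr do rewrite -opprB -iterSr.
    rewrite sumrN (telescope_sumr (fun l => f (iter l (T i) w)))// opprB.
    over.
  rewrite /= sumrB sumr_const_nat subn0 mulrBl -[X in _ = X / _ - _]mulr_natl.
  by rewrite mulrAC divff ?mul1r// pnatr_eq0.
apply: coboundaryB; apply: bmeasM; last exact: bmeas_cst.
apply: bmeas_sum => k; apply: bmeas_sum => l.
exact: (bmeas_comp (measure_preserving_iter (hT i) l) bf).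
Qed.

Lemma invariant_coboundary_approx f eps : bmeas f -> 0 < eps ->
  exists g z, [/\ bmeas g, forall i w, g (T i w) = g w, coboundary z &
    \int[P]_w `|f w - g w - z w| <= eps].
Proof.
move=> + eps0.
(* The alternative in the second clause carries through the induction the invariances that f already
   has, while s lists the maps still to be treated. *)
suff H (s : seq 'I_d) : forall e f, 0 < e -> bmeas f ->
  exists g z, [/\ bmeas g,
     forall i, (i \in s) || `[< forall w, f (T i w) = f w >] -> forall w,
       g (T i w) = g w,
     coboundary z & \int[P]_w `|f w - g w - z w| <= e].
  move=> bf; have [g [z [bg gT cz Iz]]] := H (enum 'I_d) _ _ eps0 bf.
  by exists g, z; split => // i w; apply: gT; rewrite mem_enum.
elim: s => [|i s IH] e {}f e0 bf.
  exists f, (fun=> 0); split => //; [by move=> i /asboolP|exact: coboundary0|].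
  under eq_Rintegral do rewrite subrr subr0 normr0.
  by rewrite Rintegral_cst// mul0r ltW.
have e20 : 0 < e / 2 by lra.
pose g1 := birkhoff_sup (T i) f.
have bg1 : bmeas g1 := birkhoff_sup_bmeas (hT i) bf.
have /cvgrPdist_lt /(_ _ e20) [n _ /(_ n (leqnn _)) /= In] :=
  birkhoff (hT i) bf.
have [g [z [bg gT cz Iz]]] := IH _ _ e20 bg1.
(* One half of e pays for replacing the T_i-average of f by its limit [g1], the other half for the
   approximation of [g1]. *)
exists g, (fun w => (f w - birkhoff_avg (T i) f n w) + z w); split => //.
- move=> k; rewrite inE => /orP H; apply: gT.
  have [->|ki] := eqVneq k i.
    by apply/orP; right; apply/asboolP => w; exact: birkhoff_sup_invariant.
  case: H => [|/asboolP fk]; first by rewrite (negPf ki) /= => ->.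
  apply/orP; right; apply/asboolP => w; apply: birkhoff_sup_comm => // w'.
  by have /(congr1 (@^~ w')) := hTcomm k i.
- by apply: coboundaryD => //; exact: birkhoff_avg_coboundary.
- have bavg := birkhoff_avg_bmeas (hT i) n bf.
  have bz := coboundary_bmeas cz.
  have b1 : bmeas (fun w => `|birkhoff_avg (T i) f n w - g1 w|).
    by apply: bmeas_norm; exact: bmeasB.
  have b2 : bmeas (fun w => `|g1 w - g w - z w|).
    by apply: bmeas_norm; apply: bmeasB => //; exact: bmeasB.
  apply: (@le_trans _ _ (\int[P]_w (`|birkhoff_avg (T i) f n w - g1 w| +
      `|g1 w - g w - z w|))).
    apply: le_Rintegral => //.
    - apply: bmeas_integrable; apply: bmeas_norm; apply: bmeasB;
        first exact: bmeasB.
      by apply: bmeasD => //; exact: bmeasB.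
    - by apply: bmeas_integrable; exact: bmeasD.
    - move=> w _; apply: le_trans (ler_normD _ _).
      by rewrite le_eqVlt; apply/orP; left; apply/eqP; congr (`|_|); ring.
  rewrite RintegralD//; [|exact: bmeas_integrable..].
  have : \int[P]_w `|birkhoff_avg (T i) f n w - g1 w| < e / 2.
    move: In; rewrite sub0r normrN ger0_norm//; exact: Rintegral_ge0.
  by move: Iz; lra.
Qed.

End decomposition.

(** * Exceptional sets and truncation *)

(** The exceptional sets below are only covered by measurable sets of small measure, not shown to be
    measurable themselves. *)
Lemma negligible_small (R : realType) (disp : measure_display)
  (Om : measurableType disp) (P : probability Om R) (A : set Om) :
  (forall eps : R, 0 < eps -> exists B, [/\ measurable B, A `<=` B &
    (P B <= eps%:E)%E]) ->
  P.-negligible A.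
Proof.
move=> H; have /choice [B HB] : forall n : nat, exists B,
    [/\ measurable B, A `<=` B & (P B <= (n.+1%:R^-1)%:E)%E] by move=> n;
      exact: H.
have mB : measurable (\bigcap_n B n).
  by apply: bigcap_measurable => // n _; have [] := HB n.
exists (\bigcap_n B n); split=> //; last by move=> w Aw n _; have [_ + _] :=
  HB n; apply.
apply/eqP; rewrite eq_le measure_ge0 andbT; apply/lee_addgt0Pr => e e0.
rewrite add0e; have [N _ /(_ N (leqnn _)) /= hN] := @near_infty_natSinv_lt R
  (PosNum e0).
apply: (@le_trans _ _ (P (B N))).
  apply: le_measure; rewrite ?inE//; first by have [] := HB N.
  exact: bigcap_inf.
by have [_ _ /le_trans] := HB N; apply; rewrite lee_fin ltW.
Qed.

Lemma markov_measure (R : realType) (disp : measure_display)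
  (Om : measurableType disp) (P : probability Om R) (a : Om -> R) (lam : R) :
  measurable_fun [set: Om] a -> (forall w, 0 <= a w) -> 0 <= lam ->
  (lam%:E * P [set w | (lam < a w)%R] <= \int[P]_w (a w)%:E)%E.
Proof.
move=> ma a0 lam0; have mE := measurable_superlevel lam ma.
rewrite -[P _](_ : \int[P]_(w in setT) (\1_([set w | lam < a w]) w)%:E = _)%E;
  last first.
  by rewrite integral_indic// setIT.
rewrite -ge0_integralZl_EFin//; last by apply/measurable_EFinP; exact:
  measurable_indic.
apply: ge0_le_integral => //.
- by move=> w _; rewrite mule_ge0.
- by apply: emeasurable_funM => //; apply/measurable_EFinP; exact:
    measurable_indic.
- exact/measurable_EFinP.
- move=> w _; rewrite -EFinM lee_fin indicE; case: (boolP (w \in _)) => [|_];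
    last by rewrite mulr0.
  by rewrite inE /= mulr1 => /ltW.
Qed.

Definition trunc_at (R : realType) (X : Type) (n : nat) (f : X -> R)
  (w : X) : R :=
  Num.max (- n%:R) (Num.min n%:R (f w)).

Section truncation.
Context (R : realType) (disp : measure_display) (Om : measurableType disp)
  (P : probability Om R) (f : Om -> R).

Lemma trunc_at_bmeas n : measurable_fun [set: Om] f -> bmeas (trunc_at n f).
Proof.
move=> mf; split.
  by apply: measurable_maxr; [exact: measurable_cst|exact: measurable_minr].
exists n%:R => w; rewrite ler_norml /trunc_at le_max lexx /=
  ge_max ge_min lexx andbT.
by rewrite (@le_trans _ _ 0)// oppr_le0.
Qed.

Lemma trunc_at_dist n w : `|f w - trunc_at n f w| <= `|f w|.
Proof.
rewrite /trunc_at; have n0 : 0 <= n%:R :> R by [].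
by case: (leP n%:R (f w)) => h1; case: (leP (- n%:R) _) => h2;
  rewrite ?subrr ?normr0//; case: (ger0P (f w)) => h3; rewrite ler_norml; lra.
Qed.

Lemma trunc_at_eq n w : `|f w| <= n%:R -> trunc_at n f w = f w.
Proof. by rewrite ler_norml /trunc_at => /andP[h1 h2];
  rewrite min_r// max_r. Qed.

Lemma trunc_at_cvg p : 1 <= p -> measurable_fun [set: Om] f ->
  P.-integrable [set: Om] (fun w => (`|f w| `^ p)%:E) ->
  (\int[P]_w (`|f w - trunc_at n f w| `^ p)%:E)%E @[n --> \oo] --> 0%E.
Proof.
move=> p1 mf fi; have p0 : 0 < p by exact: lt_le_trans p1.
have mtr n : measurable_fun [set: Om] (fun w => `|f w - trunc_at n f w| `^ p).
  apply: (measurableT_comp (measurable_powR p)).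
  by apply: measurableT_comp => //; apply: measurable_funB => //;
    exact: (trunc_at_bmeas n mf).1.
have -> : 0%E = (\int[P]_w (0 : \bar R))%E by rewrite integral0.
apply: (dominated_cvg _ (g := fun w => (`|f w| `^ p)%:E)) => //.
- by move=> n; exact/measurable_EFinP.
- move=> w _; apply: cvg_near_cst.
  have := @nbhs_infty_ger R `|f w|; apply: filterS => n /= fn.
  by rewrite trunc_at_eq// subrr normr0 powR0// gt_eqF.
- move=> n w _; rewrite lee_fin ger0_norm ?powR_ge0//.
  by apply: ge0_ler_powR; rewrite ?nnegrE ?(ltW p0)//; exact: trunc_at_dist.
Qed.

End truncation.

(** * Conditional expectation on the invariant sets *)

Section condexp_invariant.
Context (R : realType) (disp : measure_display) (Om : measurableType disp)
  (P : probability Om R) (d : nat) (T : 'I_d -> Om -> Om).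
Context (hT : forall i, measure_preserving P (T i)).
Context (f : Om -> R) (fint : P.-integrable [set: Om] (EFin \o f)).

Let E := condexp P (invariant_sets T) f.

Let EP : is_condexp P (invariant_sets T) f E.
Proof.
have [sI Im] := invariant_sets_sigma_algebra T; exact: condexpP.
Qed.

Lemma condexp_measurable : measurable_fun [set: Om] E.
Proof. by have [_ + _] := EP; move=> /measurable_int /measurable_EFinP. Qed.

Lemma condexp_integrable : P.-integrable [set: Om] (EFin \o E).
Proof. by have [] := EP. Qed.

(** Members of [invariant_sets] equal their preimages exactly, so invariance holds at every point:
    apply this to the level set of E through w. *)
Lemma condexp_invariant i w : E (T i w) = E w.
Proof.
have [+ _ _] := EP => /(_ _ (measurable_set1 (E w))) [_ /(_ i) TA].
by have : (E @^-1` [set E w]) w by []; rewrite -[X in X w]TA.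
Qed.

(* Integrate the difference over {g <= E} and over its complement, which are
   both invariant. *)
Lemma condexp_dist_le g z : bmeas g -> (forall i w, g (T i w) = g w) ->
  coboundary T z ->
  \int[P]_w `|E w - g w| <= \int[P]_w `|f w - g w - z w|.
Proof.
move=> bg gT cz; pose D w := E w - g w.
have bz := coboundary_bmeas hT cz.
have iD : P.-integrable [set: Om] (EFin \o D).
  rewrite (_ : _ \o _ = (EFin \o E) \- (EFin \o g))%E//.
  by apply: integrableB => //; [exact: condexp_integrable|exact:
    bmeas_integrable].
pose r w := f w - g w - z w.
have ir : P.-integrable [set: Om] (EFin \o r).
  rewrite (_ : _ \o _ = ((EFin \o f) \- (EFin \o g)) \- (EFin \o z))%E//.
  by apply: integrableB => //; [apply: integrableB => //|]; exact:
    bmeas_integrable.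
have IA A : invariant_sets T A -> \int[P]_(w in A) D w = \int[P]_(w in A) r w.
  move=> iA; have mA := iA.1.
  have sub h : P.-integrable [set: Om] (EFin \o h) ->
    P.-integrable A (EFin \o h).
    by move=> ih; exact: integrableS ih.
  have ifg : P.-integrable [set: Om] (EFin \o (fun w => f w - g w)).
    rewrite (_ : _ \o _ = (EFin \o f) \- (EFin \o g))%E//.
    by apply: integrableB => //; exact: bmeas_integrable.
  rewrite /D /r RintegralB//; [|exact: sub condexp_integrable|exact:
    sub (bmeas_integrable P bg)].
  rewrite RintegralB//; [|exact: sub|exact: sub (bmeas_integrable P bz)].
  rewrite (Rintegral_coboundary hT cz iA) subr0.
  rewrite RintegralB//; [|exact: sub|exact: sub (bmeas_integrable P bg)].
  by have [_ _ /(_ A iA) EA] := EP; rewrite /Rintegral EA.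
pose A := [set w | 0 <= D w].
have DT i w : D (T i w) = D w by rewrite /D condexp_invariant gT.
have mD : measurable_fun [set:
  Om] D by exact/measurable_EFinP/(measurable_int P iD).
have AC : ~` A = [set w | D w < 0].
  by rewrite eqEsubset; split=> w /=; rewrite ltNge => /negP.
have mA : measurable A.
  rewrite -(setCK A) AC; apply: measurableC.
  rewrite (_ : [set w | D w < 0] = [set: Om] `&` D @^-1` `]-oo, 0[%classic);
    first exact: mD.
  by rewrite setTI eqEsubset; split=> w /=; rewrite in_itv.
have iA : invariant_sets T A.
  by split => // k; rewrite eqEsubset; split=> w /=; rewrite /A/= DT.
have iAC : invariant_sets T (~` A).
  split; first exact: measurableC.
  by move=> k; rewrite -preimage_setC (iA.2 k).
have split_int h : P.-integrable [set: Om] (EFin \o h) ->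
    \int[P]_w h w = \int[P]_(w in A) h w + \int[P]_(w in ~` A) h w.
  move=> ih; rewrite -(setUv A) Rintegral_setU ?setUv//; first exact:
    measurableC.
  by apply/disj_setPS; rewrite setICr.
have subA h B : measurable B -> P.-integrable [set: Om] (EFin \o h) ->
    P.-integrable B (EFin \o h) by move=> mB; exact: integrableS.
have inD := integrable_norm iD; have inr := integrable_norm ir.
rewrite (split_int _ inD) (split_int _ inr); apply: lerD.
  rewrite (@eq_Rintegral _ _ _ P A D); last by move=> w; rewrite inE => wA /=;
    rewrite ger0_norm.
  rewrite IA//; apply: le_Rintegral => //; [exact: subA|exact: subA|].
  by move=> w _; exact: ler_norm.
have mAC := measurableC mA.
rewrite (@eq_Rintegral _ _ _ P (~` A) (fun w => -1 * D w)); last first.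
  by move=> w; rewrite inE AC => wA /=; rewrite ltr0_norm// mulN1r.
rewrite RintegralZl//; last exact: subA.
rewrite IA// -RintegralZl//; last exact: subA.
apply: le_Rintegral => //; last first.
- by move=> w _; rewrite mulN1r /= -normrN; exact: ler_norm.
- exact: subA.
- rewrite (_ : _ \o _ = fun w => (-1)%:E * (r w)%:E)%E//.
  by apply: integrableZl => //; exact: subA.
Qed.

End condexp_invariant.

Lemma cvge_distP (R : realType) (x : nat -> \bar R) (l : R) :
  (forall eps : R, 0 < eps -> \forall n \near \oo,
    (`|x n - l%:E| <= eps%:E)%E) ->
  x n @[n --> \oo] --> l%:E.
Proof.
move=> H.
have finx e n : (`|x n - l%:E| <= e%:E)%E -> x n \is a fin_num by case: (x n).
apply/fine_cvgP; split.
  by apply: filterS (H 1 ltr01) => n; exact: finx.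
apply/cvgrPdist_le => e e0; apply: filterS (H e e0) => n xn /=.
have fn := finx _ _ xn; move: fn xn; case: (x n) => //= r _.
by rewrite lee_fin distrC.
Qed.

(** * Almost sure convergence for integrable functions *)

Section ergodic_ae.
Context (R : realType) (disp : measure_display) (Om : measurableType disp)
  (P : probability Om R) (d : nat) (hd : (0 < d)%N) (T Tinv : 'I_d -> Om -> Om).
Context (hTK : forall i, cancel (T i) (Tinv i)).
Context (hTinvK : forall i, cancel (Tinv i) (T i)).
Context (hT : forall i, measure_preserving P (T i)).
Context (hTinv : forall i, measure_preserving P (Tinv i)).
Context (hTcomm : forall i k, T i \o T k = T k \o T i).
Context (kappa : \bar R) (hkappa : (1 <= kappa)%E) (psi : 'rV[R]_d -> R).
Context (theta : R -> R) (theta_good : dgood d theta)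
  (psi_theta : forall x, `|psi x| <= theta (ellnorm kappa x)).
Context (C : R) (C0 : 0 < C)
  (HC : forall N, \sum_(0 <= m < N) theta m%:R * m.+1%:R ^+ d <= C).
Context (hpsi2 : forall i : 'I_d,
    normalized_sum n (fun j : 'rV[int]_d =>
      `|psi (scaled R n j) - psi (scaled R n (j + delta_mx 0 i))|)
    @[n --> \oo] --> 0%E).
Context (c : R)
  (hpsi3 : normalized_sum n (fun j : 'rV[int]_d => psi (scaled R n j))
    @[n --> \oo] --> c%:E).

Local Notation act := (Zd_act T Tinv).

Lemma coboundary_orbit_null z w : coboundary T z ->
  kavg_null psi (fun j => z (act j w)).
Proof.
elim=> [|f g _ nf _ ng|i h [_ [H hH]]]; first exact:
  (kavg_null0 hd hkappa theta_good psi_theta HC).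
- exact: (kavg_nullD hd hkappa theta_good psi_theta HC nf ng).
- have H0 : 0 <= `|H| by [].
  have hH' v : `|h v| <= `|H| by exact: le_trans (hH v) (ler_norm _).
  have hTact j : h (T i (act j w)) = h (act (j + delta_mx 0 i) w).
    by rewrite addrC Zd_actD// Zd_act_delta.
  split.
    exists (3 ^+ d * (`|H| + `|H|)); first by rewrite mulr_ge0 ?exprn_ge0
      ?addr_ge0.
    apply: cube_bounded_cst; first exact: addr_ge0.
    by move=> j; apply: le_trans (ler_normB _ _) _; rewrite lerD.
  under eq_fun do under eq_fun do rewrite hTact.
  by apply: (kavg_coboundary hd hkappa theta_good psi_theta HC H0).
Qed.

Lemma cube_bounded_orbit (r : Om -> R) (lam : R) w :
  ~ max_exceeds T Tinv (fun v => `|r v|) lam w ->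
  cube_bounded (fun j => r (act j w)) lam.
Proof.
by move=> nM N N0; rewrite leNgt; apply/negP => H; apply: nM; exists N.
Qed.

Section integrable.
Context (f : Om -> R) (fint : P.-integrable [set: Om] (EFin \o f)).

Let mf : measurable_fun [set: Om] f.
Proof. exact/measurable_EFinP/(measurable_int P fint). Qed.

(** Truncation, by the case p = 1 of [trunc_at_cvg], reduces the approximation to bounded
    functions. *)
Lemma L1_approx eps : 0 < eps -> exists g z, [/\ bmeas g,
  forall i w, g (T i w) = g w, coboundary T z &
  \int[P]_w `|f w - g w - z w| <= eps].
Proof.
move=> e0; have e20 : 0 < eps / 2 by lra.
have fi1 : P.-integrable [set: Om] (fun w => (`|f w| `^ 1)%:E).
  under eq_fun do rewrite powRr1//; exact: integrable_norm.
have [_ /cvgrPdist_le /(_ _ e20) [n _ /(_ n (leqnn _)) /= In]] :=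
  (fine_cvgP _ _).1 (trunc_at_cvg (lexx 1) mf fi1).
have btr := trunc_at_bmeas n mf.
have [g [z [bg gT cz Iz]]] := invariant_coboundary_approx hT hTcomm btr e20.
exists g, z; split => //.
have bz := coboundary_bmeas hT cz.
have i1 : P.-integrable [set: Om] (EFin \o (fun w => f w - trunc_at n f w)).
  rewrite (_ : _ \o _ = (EFin \o f) \- (EFin \o trunc_at n f))%E//.
  by apply: integrableB => //; exact: bmeas_integrable.
have b2 : bmeas (fun w => trunc_at n f w - g w - z w) by apply: bmeasB => //;
  exact: bmeasB.
have i2 := bmeas_integrable P b2.
have i3 : P.-integrable [set: Om] (EFin \o (fun w => f w - g w - z w)).
  rewrite (_ : _ \o _ = ((EFin \o f) \- (EFin \o g)) \- (EFin \o z))%E//.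
  by apply: integrableB => //; [apply: integrableB => //|]; exact:
    bmeas_integrable.
have [n1 n2] := (integrable_norm i1, integrable_norm i2).
apply: (@le_trans _ _ (\int[P]_w (`|f w - trunc_at n f w| +
  `|trunc_at n f w - g w - z w|))).
  apply: le_Rintegral => //; first exact: integrable_norm.
    exact: (integrableD measurableT n1 n2).
  move=> w _; apply: le_trans (ler_normD _ _).
  by rewrite le_eqVlt; apply/orP; left; apply/eqP; congr (`|_|); ring.
rewrite RintegralD//.
have : \int[P]_w `|f w - trunc_at n f w| <= eps / 2.
  move: In; rewrite sub0r normrN => /(le_trans (ler_norm _)).
  by under eq_integral do rewrite powRr1//.
by move: Iz; lra.
Qed.

(** Off M and N, the triangle inequality through c g(w) gives the error C lam + lam + |c| lam. Here
    lam stays fixed while the L^1 error of the decomposition is made small, so M and N together can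
    have measure below any e. *)
Lemma ergodic_ae_eps lam : 0 < lam ->
  P.-negligible [set w | ~ \forall n \near \oo,
    (`|kavg psi n (fun j => f (act j w)) -
       (c * condexp P (invariant_sets T) f w)%:E| <=
         ((C + 1 + `|c|) * lam)%:E)%E].
Proof.
move=> lam0; apply: negligible_small => e e0.
set E := condexp P (invariant_sets T) f.
(* Chosen so that 10^d e' / lam, from the maximal inequality, and e' / lam, from Markov's
   inequality, add up to e. *)
pose e' := e * lam / (10 ^+ d + 1).
have d0 : 0 < 10 ^+ d + 1 :> R by rewrite ltr_wpDl// exprn_ge0.
have e'0 : 0 < e' by rewrite !mulr_gt0// invr_gt0.
have [g [z [bg gT cz Iz]]] := L1_approx e'0.
pose r w := f w - g w - z w.
have bz := coboundary_bmeas hT cz.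
have mr : measurable_fun [set: Om] (fun w => `|r w|).
  apply: measurableT_comp => //; apply: measurable_funB; last exact: bz.1.
  by apply: measurable_funB => //; exact: bg.1.
have mE : measurable_fun [set: Om] E := condexp_measurable T fint.
have mEg : measurable_fun [set: Om] (fun w => `|E w - g w|).
  by apply: measurableT_comp => //; apply: measurable_funB => //; exact: bg.1.
pose M := max_exceeds T Tinv (fun v => `|r v|) lam.
pose N := [set w | lam < `|E w - g w|].
have mM : measurable M by exact: (measurable_max_exceeds hT hTinv mr).
have mN : measurable N by exact: measurable_superlevel.
have ir : P.-integrable [set: Om] (EFin \o r).
  rewrite (_ : _ \o _ = ((EFin \o f) \- (EFin \o g)) \- (EFin \o z))%E//.
  by apply: integrableB => //; [apply: integrableB => //|]; exact:
    bmeas_integrable.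
have iEg : P.-integrable [set: Om] (EFin \o (fun w => E w - g w)).
  rewrite (_ : _ \o _ = (EFin \o E) \- (EFin \o g))%E//.
  by apply: integrableB => //; [exact: condexp_integrable|exact:
    bmeas_integrable].
have Ir : (\int[P]_w (`|r w|)%:E <= e'%:E)%E.
  by rewrite -(fineK (integrable_fin_num measurableT (integrable_norm ir)))
    lee_fin.
have IEg : (\int[P]_w (`|E w - g w|)%:E <= e'%:E)%E.
  rewrite -(fineK (integrable_fin_num measurableT (integrable_norm iEg)))
    lee_fin.
  exact: le_trans (condexp_dist_le hT fint bg gT cz) Iz.
have lamE : (0 < lam%:E)%E by rewrite lte_fin.
have PM : (P M <= (10 ^+ d * e' / lam)%:E)%E.
  rewrite -(@lee_pmul2l _ lam%:E)//.
  apply: le_trans (maximal_inequality hTK hTinvK hT hTinv hTcomm mr _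
    (ltW lam0)) _ => //.
  rewrite -EFinM (_ : lam * _ = 10 ^+ d * e');
    last by rewrite mulrC divfK// gt_eqF.
  by rewrite EFinM lee_wpmul2l// lee_fin exprn_ge0.
have PN : (P N <= (e' / lam)%:E)%E.
  rewrite -(@lee_pmul2l _ lam%:E)//.
  apply: le_trans (markov_measure P mEg _ (ltW lam0)) _ => //.
  by rewrite -EFinM (_ : lam * _ = e')//; rewrite mulrC divfK// gt_eqF.
exists (M `|` N); split; first exact: measurableU.
- move=> w; apply: contra_notP => /not_orP [nM nN].
  have rb := cube_bounded_orbit nM.
  have near1 := kavg_near hd hkappa theta_good psi_theta HC hpsi3 (g w)
    (coboundary_orbit_null w cz) (ltW lam0) rb lam0.
  apply: filterS near1 => n.
  have -> : (fun j => g w + z (act j w) + r (act j w)) = fun j => f (act j w).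
    apply/funext => j; rewrite /r -(Zd_act_inv hTK hTinvK j w gT); ring.
  set x := kavg _ _ _ => h.
  have Eg : `|E w - g w| <= lam by rewrite leNgt; apply/negP.
  have xfin : x \is a fin_num by move: h; case: x.
  move: h; rewrite -(fineK xfin) -!EFinB !abse_EFin !lee_fin => h.
  apply: le_trans (ler_distD (c * g w) _ _) _.
  rewrite -mulrBr normrM [X in `|c| * X]distrC.
  have : `|c| * `|E w - g w| <= `|c| * lam by rewrite ler_wpM2l.
  by lra.
- apply: le_trans (measureU2 _ _ _) _ => //.
  apply: le_trans (leeD PM PN) _; rewrite -EFinD lee_fin.
  rewrite (_ : _ + _ = e' * (10 ^+ d + 1) / lam); last by ring.
  by rewrite /e' divfK ?gt_eqF// mulfK// gt_eqF.
Qed.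

(** The exceptional sets for lam = 1 / (m + 1) have a negligible union. *)
Lemma ergodic_ae : {ae P, forall w,
  kavg psi n (fun j => f (act j w)) @[n --> \oo] -->
    (c * condexp P (invariant_sets T) f w)%:E}.
Proof.
have neg := negligible_bigcup (fun m : nat => @ergodic_ae_eps m.+1%:R^-1
  ltac:(by [])).
apply: negligibleS neg => w /= nw; apply: contrapT => nU; apply: nw.
apply: cvge_distP => e e0.
have K0 : 0 < C + 1 + `|c| by rewrite ltr_wpDr// addr_gt0.
have eK : 0 < e / (C + 1 + `|c|) by rewrite divr_gt0.
have [N _ /(_ N (leqnn _)) /= hN] := @near_infty_natSinv_lt R (PosNum eK).
have : \forall n \near \oo, (`|kavg psi n (fun j => f (act j w)) -
   (c * condexp P (invariant_sets T) f w)%:E| <=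
     ((C + 1 + `|c|) * N.+1%:R^-1)%:E)%E.
  by apply: contrapT => nN; apply: nU; exists N.
apply: filterS => n /le_trans; apply; rewrite lee_fin.
by rewrite mulrC -ler_pdivlMr// ltW.
Qed.

End integrable.

End ergodic_ae.

(** * Convergence in L^p *)

(** The bound K is asked only for large n because the averages are estimated for n > 0. *)
Lemma ae_fatou (R : realType) (disp : measure_display)
  (Om : measurableType disp) (P : probability Om R) (u : nat -> Om -> R)
  (v : Om -> R) (K : \bar R) :
  (forall n, measurable_fun [set: Om] (u n)) -> measurable_fun [set: Om] v ->
  (forall n w, 0 <= u n w) -> (forall w, 0 <= v w) ->
  {ae P, forall w, u n w @[n --> \oo] --> v w} ->
  (\forall n \near \oo, (\int[P]_w (u n w)%:E <= K)%E) ->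
  (\int[P]_w (v w)%:E <= K)%E.
Proof.
move=> mu mv u0 v0 uv uK.
have mN : measurable_fun [set: \bar R] (-%E : \bar R -> \bar R) by [].
have mU n : measurable_fun [set: Om] (EFin \o u n) by exact/measurable_EFinP.
have mNU n : measurable_fun [set: Om] (fun w => - (u n w)%:E)%E.
  exact: (measurableT_comp mN (mU n)).
have einf_ge0 w : (0 <= limn_einf (fun n => (u n w)%:E))%E.
  rewrite limn_einf_lim; apply: lime_ge; first exact: is_cvg_einfs.
  by apply: nearW => n; apply/ereal_infP => _ [m _ <-]; rewrite /= lee_fin;
    exact: u0.
apply: (@le_trans _ _ (\int[P]_w limn_einf (fun n => (u n w)%:E))%E).
  apply: ae_ge0_le_integral => //.
  - by move=> w _; rewrite lee_fin.
  - exact/measurable_EFinP.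
  - exact: (measurableT_comp mN (measurable_fun_limn_esup mNU)).
  - apply: filterS uv => w uw _.
    have uwE : (u n w)%:E @[n --> \oo] --> (v w)%:E by apply: cvg_EFin => //;
      exact: nearW.
    by rewrite is_cvg_limn_einfE ?(cvg_lim _ uwE)//; exact: cvgP uwE.
apply: le_trans (fatou P measurableT mU _) _; first by move=> n w _;
  rewrite lee_fin.
rewrite limn_einf_lim; apply: lime_le; first exact: is_cvg_einfs.
apply: filterS uK => n; apply: le_trans.
by apply: ereal_inf_lbound; exists n => /=.
Qed.

(** The limit l = 0 is treated apart: the formula x^p = exp(p ln x) serves for x > 0. *)
Lemma cvg_powR (R : realType) (u : nat -> R) (l p : R) : 0 < p ->
  (forall n, 0 <= u n) -> u n @[n --> \oo] --> l ->
    u n `^ p @[n --> \oo] --> l `^ p.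
Proof.
move=> p0 u0 ul; have l0 : 0 <= l.
  by rewrite -(cvg_lim _ ul)//; apply: limr_ge; [exact: cvgP ul|exact: nearW].
move: l0; rewrite le_eqVlt => /predU1P[l0|l0].
  rewrite -l0 powR0 ?gt_eqF//; apply/cvgrPdist_lt => e e0.
  have ep : 0 < e `^ p^-1 by rewrite powR_gt0.
  have := ul; rewrite -l0 => /cvgrPdist_lt /(_ _ ep); apply: filterS => n.
  rewrite !sub0r !normrN ger0_norm// ger0_norm ?powR_ge0// => uen.
  have -> : e = (e `^ p^-1) `^ p by rewrite -powRrM mulVf ?gt_eqF//
    powRr1// ltW.
  by apply: gt0_ltr_powR; rewrite ?nnegrE// ltW.
have E x : 0 < x -> x `^ p = expR (p * ln x) by move=> x0; rewrite /powR gt_eqF.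
rewrite E//; have near0 : \forall n \near \oo, 0 < u n.
  by move/cvgrPdist_lt : ul => /(_ _ l0); apply: filterS => n;
    rewrite ltr_norml => /andP[_]; lra.
have : expR (p * ln (u n)) @[n --> \oo] --> expR (p * ln l).
  apply: continuous_cvg; first exact: continuous_expR.
  apply: cvgM; first exact: cvg_cst.
  exact: (continuous_cvg _ (continuous_ln l0) ul).
apply: cvg_trans; apply: near_eq_cvg; apply: filterS near0 => n un.
by rewrite E.
Qed.

(** * Uniform L^p bounds and mean convergence *)

Section mean_ergodic.
Context (R : realType) (disp : measure_display) (Om : measurableType disp)
  (P : probability Om R) (d : nat) (hd : (0 < d)%N) (T Tinv : 'I_d -> Om -> Om).
Context (hTK : forall i, cancel (T i) (Tinv i)).
Context (hTinvK : forall i, cancel (Tinv i) (T i)).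
Context (hT : forall i, measure_preserving P (T i)).
Context (hTinv : forall i, measure_preserving P (Tinv i)).
Context (hTcomm : forall i k, T i \o T k = T k \o T i).
Context (kappa : \bar R) (hkappa : (1 <= kappa)%E) (psi : 'rV[R]_d -> R).
Context (theta : R -> R) (theta_good : dgood d theta)
  (psi_theta : forall x, `|psi x| <= theta (ellnorm kappa x)).
Context (C : R) (C0 : 0 < C)
  (HC : forall N, \sum_(0 <= m < N) theta m%:R * m.+1%:R ^+ d <= C).
Context (hpsi2 : forall i : 'I_d,
    normalized_sum n (fun j : 'rV[int]_d =>
      `|psi (scaled R n j) - psi (scaled R n (j + delta_mx 0 i))|)
    @[n --> \oo] --> 0%E).
Context (c : R)
  (hpsi3 : normalized_sum n (fun j : 'rV[int]_d => psi (scaled R n j))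
    @[n --> \oo] --> c%:E).
Context (p : R) (p1 : 1 <= p).

Local Notation act := (Zd_act T Tinv).
Local Notation ksum n f w := (kavg psi n (fun j => f (act j w))).
Local Notation CE f := (condexp P (invariant_sets T) f).

Let p0 : 0 < p. Proof. exact: lt_le_trans p1. Qed.

Definition Lp (f : Om -> R) := measurable_fun [set: Om] f /\
  P.-integrable [set: Om] (fun w => (`|f w| `^ p)%:E).

Lemma measurable_powR_norm (f : Om -> R) : measurable_fun [set: Om] f ->
  measurable_fun [set: Om] (fun w => `|f w| `^ p).
Proof.
by move=> mf; apply: (measurableT_comp (measurable_powR p)); exact:
  measurableT_comp.
Qed.

Lemma bmeas_Lp f : bmeas f -> Lp f.
Proof.
move=> bf; split; first exact: bf.1.
have [H fH] := bf.2; apply: (bmeas_integrable P); split.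
  exact: measurable_powR_norm bf.1.
exists (H `^ p) => w; rewrite ger0_norm ?powR_ge0//.
apply: ge0_ler_powR; rewrite ?nnegrE ?(ltW p0)//; exact: le_trans (fH w).
Qed.

Lemma Lp_integrable f : Lp f -> P.-integrable [set: Om] (EFin \o f).
Proof.
move=> [mf fi]; apply: (le_integrable measurableT _ _
  (integrableD measurableT (bmeas_integrable P (bmeas_cst _ 1)) fi)).
  exact/measurable_EFinP.
move=> w _ /=; rewrite lee_fin [leRHS]ger0_norm ?addr_ge0 ?powR_ge0//.
have [f1|f1] := leP `|f w| 1; first by rewrite ler_wpDr ?powR_ge0.
by rewrite ler_wpDl// -[leLHS]powRr1// ler_powR// ltW.
Qed.

(** From x + y <= 2 max(x, y). *)
Lemma powRD_le (x y : R) : 0 <= x -> 0 <= y ->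
  (x + y) `^ p <= 2 `^ p * (x `^ p + y `^ p).
Proof.
move=> x0 y0; wlog xy : x y x0 y0 / x <= y.
  move=> H; have [xy|/ltW yx] := leP x y; first exact: H.
  by rewrite addrC [X in _ * X]addrC; exact: H.
apply: (@le_trans _ _ ((2 * y) `^ p)).
  by apply: ge0_ler_powR; rewrite ?nnegrE ?(ltW p0) ?addr_ge0 ?mulr_ge0//; lra.
by rewrite powRM// ler_wpM2l ?powR_ge0// lerDr powR_ge0.
Qed.

(* A crude form of Young's inequality, which makes Jensen's inequality
   unnecessary up to a factor 2^p. *)
Lemma young_crude (x t : R) : 0 <= x -> 0 <= t ->
  t `^ (p - 1) * x <= t `^ p + x `^ p.
Proof.
move=> x0 t0.
have powS y : 0 <= y -> y `^ (p - 1) * y <= y `^ p.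
  rewrite le_eqVlt => /predU1P[<-|y0]; first by rewrite mulr0 powR_ge0.
  by rewrite -[X in _ * X](@powRr1 _ y) ?(ltW y0)// -powRD ?subrK// gt_eqF//
    implybT.
have [xt|/ltW tx] := leP x t.
  apply: (@le_trans _ _ (t `^ (p - 1) * t));
    first by rewrite ler_wpM2l ?powR_ge0.
  by apply: le_trans (powS _ t0) _; rewrite lerDl powR_ge0.
apply: (@le_trans _ _ (x `^ (p - 1) * x)).
  by rewrite ler_wpM2r// ge0_ler_powR ?nnegrE// subr_ge0.
by apply: le_trans (powS _ x0) _; rewrite lerDr powR_ge0.
Qed.

Lemma measurable_ksum n f : measurable_fun [set: Om] f ->
  measurable_fun [set: Om] (fun w => ksum n f w).
Proof.
move=> mf; have mfj j : measurable_fun [set: Om]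
    (fun w => (psi (scaled R n j) * f (act j w))%:E).
  apply/measurable_EFinP; apply: measurable_funM => //.
  exact: (measurableT_comp mf (measure_preserving_Zd_act j hT hTinv).1).
apply: emeasurable_funM => //; apply: emeasurable_funB.
- apply: measurable_fun_esum => [j|//].
  rewrite (_ : (fun w => _) =
    (fun w => (psi (scaled R n j) * f (act j w))%:E)^\+%E).
    exact: measurable_funepos.
  by apply/funext => w; rewrite !funeposE.
- apply: measurable_fun_esum => [j|//].
  rewrite (_ : (fun w => _) =
    (fun w => (psi (scaled R n j) * f (act j w))%:E)^\-%E).
    exact: measurable_funeneg.
  by apply/funext => w; rewrite !funenegE.
Qed.

(** A real version of the average, with 0 in place of infinite values; for integrable f and n > 0
    these occur only on a null set, by [ae_orbit_cube_bounded] and [kavg_fin]. *)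
Definition kmean n f w : R := fine (ksum n f w).

Lemma measurable_kmean n f : measurable_fun [set: Om] f ->
  measurable_fun [set: Om] (kmean n f).
Proof. by move=> mf; exact: (measurableT_comp _ (measurable_ksum n mf)). Qed.

(** Bounds the total mass of the weights n^-d |psi(j/n)|: it is the kernel bound for the constant 1,
    whose cube bound is 3^d. *)
Let W := 3 ^+ d * C.

Let W0 : 0 < W. Proof. by rewrite mulr_gt0// exprn_gt0. Qed.

Lemma esum_kernel_le n : (0 < n)%N ->
  (\esum_(j in [set: 'rV[int]_d]) ((n%:R ^+ d)^-1 * `|psi (scaled R n j)|)%:E <=
    W%:E)%E.
Proof.
move=> n0; have np : 0 < n%:R ^+ d :> R by rewrite exprn_gt0// ltr0n.
under eq_esum do rewrite EFinM.
rewrite esumZl ?invr_ge0 ?(ltW np)//.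
have b1 := @cube_bounded_cst R d (fun=> 1) 1 ler01 (fun=>
  ltac:(by rewrite normr1)).
have := kernel_domination hd hkappa theta_good psi_theta HC n0 _ b1.
rewrite mulr1 exprn_ge0// => /(_ isT).
under eq_esum do rewrite mulr1.
rewrite (_ : W = (n%:R ^+ d)^-1 * (C * 3 ^+ d * n%:R ^+ d)); last first.
  by rewrite [RHS]mulrC mulfK ?gt_eqF// mulrC.
by move=> h; rewrite [leRHS]EFinM; apply: lee_wpmul2l.
Qed.

(** Multiply v by t^(p-1) and apply [young_crude] to each term: t^(p-1) v <= t^p W + G. With t = v /
    (2W) the left side is 2 W t^p, so t^p W is absorbed and t^p W <= G remains. *)
Lemma kmean_powR_le n f w : (0 < n)%N ->
  ((`|kmean n f w| `^ p)%:E <= ((2 * W) `^ p / W)%:E *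
    \esum_(j in [set: 'rV[int]_d])
      ((n%:R ^+ d)^-1 * `|psi (scaled R n j)| * `|f (act j w)| `^ p)%:E)%E.
Proof.
move=> n0; have np : 0 < n%:R ^+ d :> R by rewrite exprn_gt0// ltr0n.
pose wt j := (n%:R ^+ d)^-1 * `|psi (scaled R n j)|.
have wt0 j : 0 <= wt j by rewrite mulr_ge0 ?invr_ge0 ?(ltW np).
set G := (\esum_(j in _) _)%E.
set v := `|kmean n f w|; have v0 : 0 <= v by exact: normr_ge0.
have W20 : 0 < 2 * W by rewrite mulr_gt0.
pose t := v / (2 * W); have t0 : 0 <= t by rewrite divr_ge0// ltW.
have vE : v = 2 * W * t by rewrite /t mulrC divfK// gt_eqF.
have vS : (v%:E <= \esum_(j in [set: 'rV[int]_d]) (wt j * `|f (act j w)|)%:E)%E.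
  apply: (@le_trans _ _ `|ksum n f w|%E).
    by rewrite /v /kmean; case: (ksum n f w) => //= [|]; rewrite ?normr0 ?leey.
  apply: le_trans (norm_kavg_le _ _ n0) _.
  rewrite -esumZl ?invr_ge0 ?(ltW np)//.
  by apply: le_esum => j _; rewrite -EFinM lee_fin normrM mulrA.
have G0 : (0 <= G)%E.
  by apply: esum_ge0 => j _; rewrite lee_fin (mulr_ge0 (wt0 j) (powR_ge0 _ _)).
have key : ((t `^ (p - 1) * v)%:E <= (t `^ p * W)%:E + G)%E.
  rewrite EFinM; apply: le_trans (lee_wpmul2l _ vS) _;
    first by rewrite lee_fin powR_ge0.
  rewrite -esumZl ?powR_ge0//; last by move=> j; rewrite lee_fin mulr_ge0//;
    exact: wt0.
  apply: (@le_trans _ _ ((t `^ p)%:E * (\esum_(j in [set: 'rV[int]_d])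
    (wt j)%:E) + G)%E).
    rewrite -esumZl ?powR_ge0// -esumD; last 2 first.
    - by move=> j _; rewrite -EFinM lee_fin (mulr_ge0 (powR_ge0 _ _) (wt0 j)).
    - by move=> j _; rewrite lee_fin (mulr_ge0 (wt0 j) (powR_ge0 _ _)).
    apply: le_esum => j _; rewrite -!EFinM -EFinD lee_fin.
    rewrite mulrCA [t `^ p * _]mulrC -mulrDr ler_wpM2l//.
    exact: young_crude.
  apply: leeD => //; rewrite EFinM; apply: lee_wpmul2l;
    first by rewrite lee_fin powR_ge0.
  exact: esum_kernel_le.
have tS : t `^ (p - 1) * t = t `^ p.
  have [->|tn0] := eqVneq t 0; first by rewrite mulr0 powR0// gt_eqF.
  by rewrite -[X in _ * X](@powRr1 _ t)// -powRD ?subrK// tn0 implybT.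
have {}key : ((t `^ p * W)%:E <= G)%E.
  move: key; rewrite vE mulrCA tS (_ : 2 * W * t `^ p = t `^ p * W + t `^ p *
    W); last by lra.
  (* The cancelled term is finite, so the subtraction is legitimate even if G is infinite. *)
  by rewrite EFinD leeD2lE.
rewrite vE powRM ?(ltW W20)//.
rewrite (_ : _ * t `^ p = (2 * W) `^ p / W * (t `^ p * W)); last first.
  by rewrite mulrA mulrAC divfK ?gt_eqF.
by rewrite EFinM lee_wpmul2l// lee_fin divr_ge0 ?powR_ge0// ltW.
Qed.

Lemma integral_kmean_powR_le n f : (0 < n)%N -> Lp f ->
  (\int[P]_w (`|kmean n f w| `^ p)%:E <=
     ((2 * W) `^ p)%:E * \int[P]_w (`|f w| `^ p)%:E)%E.
Proof.
move=> n0 [mf fi]; have np : 0 < n%:R ^+ d :> R by rewrite exprn_gt0// ltr0n.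
have mfp := measurable_powR_norm mf.
pose wt j := (n%:R ^+ d)^-1 * `|psi (scaled R n j)|.
have wt0 j : 0 <= wt j by rewrite mulr_ge0 ?invr_ge0 ?(ltW np).
have mterm j : measurable_fun [set: Om] (fun w =>
  (wt j * `|f (act j w)| `^ p)%:E).
  apply/measurable_EFinP; apply: measurable_funM => //.
  exact: (measurableT_comp mfp (measure_preserving_Zd_act j hT hTinv).1).
have term0 j w : (0 <= (wt j * `|f (act j w)| `^ p)%:E)%E.
  by rewrite lee_fin mulr_ge0 ?powR_ge0.
have W2 : 0 <= (2 * W) `^ p / W by rewrite divr_ge0 ?powR_ge0// ltW.
apply: (@le_trans _ _ (\int[P]_w (((2 * W) `^ p / W)%:E *
    \esum_(j in [set: 'rV[int]_d]) (wt j * `|f (act j w)| `^ p)%:E))%E).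
  apply: ge0_le_integral => //.
  - apply/measurable_EFinP; apply: measurable_powR_norm; exact:
      measurable_kmean.
  - by apply: emeasurable_funM => //; exact: measurable_fun_esum.
  - by move=> w _; exact: kmean_powR_le.
rewrite ge0_integralZl_EFin//; last 2 first.
- by move=> w _; exact: esum_ge0.
- exact: measurable_fun_esum.
rewrite ge0_integral_esum//.
have mfpj j : measurable_fun [set: Om] (fun w => (`|f (act j w)| `^ p)%:E).
  apply/measurable_EFinP.
  exact: (measurableT_comp mfp (measure_preserving_Zd_act j hT hTinv).1).
have If0 : (0 <= \int[P]_w (`|f w| `^ p)%:E)%E by exact: integral_ge0.
have Iact j : (\int[P]_w (`|f (act j w)| `^ p)%:E =
  \int[P]_w (`|f w| `^ p)%:E)%E.
  apply: (ge0_integral_measure_preserving (f := fun w => (`|f w| `^ p)%:E)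
    (measure_preserving_Zd_act j hT hTinv)).
    exact/measurable_EFinP.
  by move=> w; rewrite lee_fin powR_ge0.
have Ifin : (\int[P]_w (`|f w| `^ p)%:E)%E \is a fin_num.
  exact: integrable_fin_num fi.
have Ij j : (\int[P]_w (wt j * `|f (act j w)| `^ p)%:E =
    (wt j)%:E * \int[P]_w (`|f w| `^ p)%:E)%E.
  rewrite -(Iact j) -(@ge0_integralZl_EFin _ _ _ P _ measurableT _ _ (mfpj j) _
    (wt0 j)).
    by apply: eq_integral => w _; rewrite EFinM.
  by move=> w _; rewrite lee_fin powR_ge0.
set I := (\int[P]_w (`|f w| `^ p)%:E)%E in Iact If0 Ifin Ij *.
under eq_esum do rewrite Ij muleC.
rewrite -(fineK Ifin) esumZl ?fine_ge0//.
apply: (@le_trans _ _ (((2 * W) `^ p / W)%:E * ((fine I)%:E * W%:E))%E).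
  apply: lee_wpmul2l; first by rewrite lee_fin.
  by apply: lee_wpmul2l; [rewrite lee_fin fine_ge0|exact: esum_kernel_le].
rewrite -[in leRHS](fineK Ifin) -!EFinM lee_fin le_eqVlt; apply/orP; left;
  apply/eqP.
by rewrite mulrCA divfK ?gt_eqF// mulrC.
Qed.

(** The maximal function of an integrable f is finite a.s.; this is the source of the a.s. absolute
    convergence of the ergodic sums. *)
Lemma ae_orbit_cube_bounded f : P.-integrable [set: Om] (EFin \o f) ->
  {ae P, forall w, exists2 lam, 0 <= lam &
    cube_bounded (fun j => f (act j w)) lam}.
Proof.
move=> fi; apply: negligible_small => e e0.
have nfi := integrable_norm fi.
have Ifin := integrable_fin_num measurableT nfi.
set I := (\int[P]_(_ in _) _)%E in Ifin.
have I0 : (0 <= I)%E by apply: integral_ge0 => w _; rewrite /=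
  lee_fin normr_ge0.
(* With this lam the maximal inequality gives measure at most e; the added 1 keeps lam positive. *)
pose lam := 10 ^+ d * fine I / e + 1.
have lam0 : 0 < lam by rewrite ltr_wpDl// divr_ge0 ?(ltW e0)// mulr_ge0
  ?exprn_ge0 ?fine_ge0.
have mf : measurable_fun [set: Om] (fun w => `|f w|).
  by apply/measurable_EFinP; exact: measurable_int nfi.
exists (max_exceeds T Tinv (fun v => `|f v|) lam); split.
- exact: (measurable_max_exceeds hT hTinv mf).
- move=> w /=; apply: contra_notP => nM; exists lam; first exact: ltW.
  exact: cube_bounded_orbit nM.
- rewrite -(@lee_pmul2l _ lam%:E) ?lte_fin//.
  apply: le_trans (maximal_inequality hTK hTinvK hT hTinv hTcomm mf _
    (ltW lam0)) _ => //.
  rewrite -[X in (_ * X)%E](fineK Ifin) -!EFinM lee_fin /lam mulrDl divfK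
    ?gt_eqF//.
  by rewrite lerDl mul1r ltW.
Qed.

Lemma kmean_cvg f : P.-integrable [set: Om] (EFin \o f) ->
  {ae P, forall w, kmean n f w @[n --> \oo] --> c * CE f w}.
Proof.
move=> fi.
have := ergodic_ae hd hTK hTinvK hT hTinv hTcomm hkappa theta_good psi_theta C0
  HC hpsi2 hpsi3 fi.
by apply: filterS => w; exact: fine_cvg.
Qed.

(** Fatou replaces the conditional Jensen inequality and controls the product of c with the
    conditional expectation, which is what the limit involves. *)
Lemma integral_condexp_powR_le f : Lp f ->
  (\int[P]_w (`|c * CE f w| `^ p)%:E <=
     ((2 * W) `^ p)%:E * \int[P]_w (`|f w| `^ p)%:E)%E.
Proof.
move=> Lf; have fi := Lp_integrable Lf.
have mCE : measurable_fun [set: Om] (CE f) := condexp_measurable T fi.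
apply: (ae_fatou (u := fun n w => `|kmean n f w| `^ p)) => //.
- by move=> n; apply: measurable_powR_norm; apply: measurable_kmean;
    exact: Lf.1.
- by apply: measurable_powR_norm; exact: measurable_funM.
- apply: filterS (kmean_cvg fi) => w fw.
  by apply: cvg_powR => //; exact: cvg_norm.
- by exists 1%N => // n /= n0; exact: integral_kmean_powR_le.
Qed.

Lemma cube_bounded_kmean_le b (H : R) n w : 0 <= H -> (forall w, `|b w| <= H) ->
  `|kmean n b w| <= W * H.
Proof.
(* Dominated convergence wants a bound for every n; at n = 0 the inverse of 0^d = 0 is 0, which
   makes the average 0. *)
move=> H0 bH; have [n0|n0] := posnP n.
  rewrite /kmean /kavg /normalized_sum n0 expr0n gtn_eqF//= invr0 mul0e normr0.
  by rewrite mulr_ge0// ltW.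
have bb := @cube_bounded_cst R d (fun j => b (act j w)) H H0 (fun=> bH _).
have H3 : 0 <= 3 ^+ d * H by rewrite mulr_ge0// exprn_ge0.
have kfin := kavg_fin hd hkappa theta_good psi_theta HC n0 H3 bb.
have := kavg_le hd hkappa theta_good psi_theta HC n0 H3 bb.
rewrite -(fineK kfin) abse_EFin lee_fin => /le_trans; apply.
by rewrite /W mulrA [C * _]mulrC.
Qed.

Lemma mean_ergodic_bounded b : bmeas b ->
  (\int[P]_w (`|kmean n b w - c * CE b w| `^ p)%:E)%E @[n --> \oo] --> 0%E.
Proof.
move=> bb; have Lb := bmeas_Lp bb; have bi := Lp_integrable Lb.
have mCE : measurable_fun [set: Om] (CE b) := condexp_measurable T bi.
have mcCE : measurable_fun [set: Om] (fun w => c * CE b w) by exact: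
  measurable_funM.
have [H bH] := bb.2.
have bH' w : `|b w| <= `|H| by apply: le_trans (bH w) (ler_norm _).
(* [CE b] has not been shown to be bounded, so its power stays in the dominating function;
   [integral_condexp_powR_le] makes it integrable. *)
pose dom w := 2 `^ p * ((W * `|H|) `^ p + `|c * CE b w| `^ p).
have idom : P.-integrable [set: Om] (EFin \o dom).
  have i1 : P.-integrable [set: Om] (fun w => (`|c * CE b w| `^ p)%:E).
    apply/integrableP; split.
      by apply/measurable_EFinP; exact: measurable_powR_norm.
    under eq_integral do rewrite abse_EFin (ger0_norm (powR_ge0 _ _)).
    apply: le_lt_trans (integral_condexp_powR_le Lb) _.
    rewrite lte_mul_pinfty ?lee_fin ?powR_ge0//.
    by rewrite ltey_eq (integrable_fin_num measurableT Lb.2).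
  have i2 := bmeas_integrable P (bmeas_cst Om ((W * `|H|) `^ p)).
  exact: (integrableZl measurableT (2 `^ p) (integrableD measurableT i2 i1)).
have mu n : measurable_fun [set: Om] (fun w => `|kmean n b w - c *
  CE b w| `^ p).
  by apply: measurable_powR_norm; apply: measurable_funB => //;
    apply: measurable_kmean; exact: bb.1.
have [|||||_ _ cv] := @dominated_convergence _ _ _ P setT measurableT
  (fun n w => (`|kmean n b w - c * CE b w| `^ p)%:E) (cst 0%E) (EFin \o dom).
- by move=> n; exact/measurable_EFinP.
- exact: measurable_cst.
- apply: filterS (kmean_cvg bi) => w bw _.
  apply: cvg_EFin; first exact: nearW.
  rewrite (_ : 0 = 0 `^ p); last by rewrite powR0// gt_eqF.
  apply: cvg_powR => //; rewrite -(normr0 R); apply: cvg_norm.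
  by rewrite -(subrr (c * CE b w)); apply: cvgB => //; exact: cvg_cst.
- exact: idom.
- apply: aeW => w n _; rewrite /= lee_fin ger0_norm ?powR_ge0//.
  apply: (@le_trans _ _ ((`|kmean n b w| + `|c * CE b w|) `^ p)).
    by apply: ge0_ler_powR; rewrite ?nnegrE ?(ltW p0) ?addr_ge0//; exact:
      ler_normB.
  apply: le_trans (powRD_le _ _) _ => //.
  rewrite ler_wpM2l ?powR_ge0// lerD2r.
  apply: ge0_ler_powR; rewrite ?nnegrE ?(ltW p0)//.
    by rewrite (mulr_ge0 (ltW W0)).
  exact: cube_bounded_kmean_le.
- by rewrite integral0 in cv; exact: cv.
Qed.

Lemma powR_dist_split_le (x y x' y' : R) :
  ((`|x + y - (x' + y')| `^ p)%:E <=
  (2 `^ p)%:E * ((`|x - x'| `^ p)%:E +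
    (2 `^ p)%:E * ((`|y| `^ p)%:E + (`|y'| `^ p)%:E)))%E.
Proof.
have : `|x + y - (x' + y')| `^ p <=
    2 `^ p * (`|x - x'| `^ p + 2 `^ p * (`|y| `^ p + `|y'| `^ p)).
  apply: (@le_trans _ _ ((`|x - x'| + (`|y| + `|y'|)) `^ p)).
    apply: ge0_ler_powR; rewrite ?nnegrE ?(ltW p0) ?addr_ge0//.
    rewrite (_ : x + y - (x' + y') = (x - x') + (y - y')); last by ring.
    by apply: le_trans (ler_normD _ _) _; rewrite lerD2l; exact: ler_normB.
  apply: le_trans (powRD_le _ _) _; rewrite ?addr_ge0//.
  by rewrite ler_wpM2l ?powR_ge0// lerD2l; exact: powRD_le.
by rewrite -lee_fin EFinM EFinD EFinM EFinD.
Qed.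

Lemma Lp_trunc_at_dist n f : Lp f -> Lp (fun w => f w - trunc_at n f w).
Proof.
move=> [mf fi]; have mD : measurable_fun [set: Om] (fun w =>
  f w - trunc_at n f w).
  by apply: measurable_funB => //; exact: (trunc_at_bmeas n mf).1.
split => //; apply: le_integrable fi => //.
  by apply/measurable_EFinP; exact: measurable_powR_norm.
move=> w _; rewrite !abse_EFin lee_fin !(ger0_norm (powR_ge0 _ _)).
by apply: ge0_ler_powR; rewrite ?nnegrE ?(ltW p0)//; exact: trunc_at_dist.
Qed.

(** With f = b + D, where b is a truncation, the bounded case handles b, and the L^p bounds make
    both the averages of D and their limit small, uniformly in n >= 1. *)
Lemma mean_ergodic f : Lp f ->
  (\int[P]_w (`|kmean n f w - c * CE f w| `^ p)%:E)%E @[n --> \oo] --> 0%E.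
Proof.
move=> Lf; have fi := Lp_integrable Lf.
(* The powers are made opaque, so that the final computation sees only the positive constants K1 and
   K2. *)
have [K1 K1E] : exists k, k = 2 `^ p by eexists.
have [K2 K2E] : exists k, k = (2 * W) `^ p by eexists.
(* The average of D and its limit each contribute K1 K1 K2 (e / 2 / K) = e / 4; the bounded part
   contributes the other e / 2. *)
pose K := 2 * (K1 * K1 * K2).
have K10 : 0 < K1 by rewrite K1E powR_gt0.
have K20 : 0 < K2 by rewrite K2E powR_gt0// mulr_gt0.
have K0 : 0 < K by rewrite !mulr_gt0.
suff main e : 0 < e -> \forall n \near \oo,
    (\int[P]_w (`|kmean n f w - c * CE f w| `^ p)%:E <= e%:E)%E.
  apply: cvge_distP => e /main; apply: filterS => n.
  by rewrite sube0 gee0_abs// integral_ge0// => w _; rewrite lee_fin powR_ge0.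
move=> e0; have eK : 0 < e / 2 / K by rewrite !divr_gt0.
have eK1 : 0 < e / 2 / K1 by rewrite !divr_gt0.
have [N ID] : exists N, (\int[P]_w (`|f w - trunc_at N f w| `^ p)%:E <=
  (e / 2 / K)%:E)%E.
  have /fine_cvgP[fN /cvgrPdist_le /(_ _ eK) dN] := trunc_at_cvg p1 Lf.1 Lf.2.
  have [N [/= h1 h2]] := filter_ex (filterI fN dN).
  exists N; rewrite -(fineK h1) lee_fin; move: h2.
  by rewrite sub0r normrN; apply: le_trans; exact: ler_norm.
pose b := trunc_at N f; pose D w := f w - b w.
have bb : bmeas b := trunc_at_bmeas N Lf.1.
have bi := Lp_integrable (bmeas_Lp bb).
have LD : Lp D := Lp_trunc_at_dist N Lf.
have Di := Lp_integrable LD.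
have mCE g : P.-integrable [set: Om] (EFin \o g) -> measurable_fun [set:
  Om] (fun w => c * CE g w).
  by move=> gi; apply: measurable_funM => //; exact: condexp_measurable.
have mdiff n g : Lp g -> measurable_fun [set: Om] (fun w => `|kmean n g w - c *
  CE g w| `^ p).
  move=> Lg; apply: measurable_powR_norm; apply: measurable_funB.
    by apply: measurable_kmean; exact: Lg.1.
  by apply: mCE; exact: Lp_integrable.
have [H bH] := bb.2.
have bH' w : `|b w| <= `|H| by apply: le_trans (bH w) (ler_norm _).
have kD : {ae P, forall w, forall n, (0 < n)%N -> kmean n f w = kmean n b w +
  kmean n D w}.
  apply: filterS (ae_orbit_cube_bounded Di) => w [lam lam0 Dw] n n0.
  have H3 : 0 <= 3 ^+ d * `|H| by rewrite mulr_ge0// exprn_ge0.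
  have bw := @cube_bounded_cst R d (fun j => b (act j w)) `|H| (normr_ge0 _)
    (fun=> bH' _).
  rewrite /kmean -fineD;
    [|exact: (kavg_fin hd hkappa theta_good psi_theta HC n0 H3 bw)
    |exact: (kavg_fin hd hkappa theta_good psi_theta HC n0 lam0 Dw)].
  rewrite -(kavgD hd hkappa theta_good psi_theta HC n0 H3 lam0 bw Dw).
  by congr (fine (kavg _ _ _)); apply/funext => j; rewrite /D addrC subrK.
(* Additivity of the limit follows from that of the averages by uniqueness of limits. *)
have CED : {ae P, forall w, c * CE f w = c * CE b w + c * CE D w}.
  apply: filterS (filterI kD (filterI (kmean_cvg fi) (filterI (kmean_cvg bi)
    (kmean_cvg Di)))).
  move=> w [kw [fw [bw Dw]]].
  have bDw : (kmean n b w + kmean n D w) @[n --> \oo] --> c * CE b w +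
    c * CE D w.
    exact: cvgD.
  have fw' : kmean n f w @[n --> \oo] --> c * CE b w + c * CE D w.
    move: bDw; apply: cvg_trans; apply: near_eq_cvg.
    by exists 1%N => // n /= n0; rewrite kw.
  by rewrite -[LHS](cvg_lim _ fw)// -[RHS](cvg_lim _ fw').
have := mean_ergodic_bounded bb => /fine_cvgP[fb /cvgrPdist_le /(_ _ eK1)] db.
near=> n.
have n0 : (0 < n)%N by near: n; exists 1%N.
have Ib : (\int[P]_w (`|kmean n b w - c * CE b w| `^ p)%:E <=
  (e / 2 / K1)%:E)%E.
  have h1 : (\int[P]_w (`|kmean n b w - c * CE b w| `^ p)%:E)%E \is a fin_num.
    by near: n; exact: fb.
  rewrite -(fineK h1) lee_fin; apply: le_trans (ler_norm _) _.
  by rewrite -normrN -sub0r; near: n; exact: db.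
pose F1 w := (`|kmean n b w - c * CE b w| `^ p)%:E.
pose F2 w := (`|kmean n D w| `^ p)%:E.
pose F3 w := (`|c * CE D w| `^ p)%:E.
have mF1 : measurable_fun [set: Om] F1 by apply/measurable_EFinP/mdiff; exact:
  bmeas_Lp.
have mF2 : measurable_fun [set: Om] F2.
  by apply/measurable_EFinP/measurable_powR_norm/measurable_kmean; exact: LD.1.
have mF3 : measurable_fun [set: Om] F3.
  by apply/measurable_EFinP/measurable_powR_norm; exact: mCE.
have F10 w : (0 <= F1 w)%E by rewrite lee_fin powR_ge0.
have F20 w : (0 <= F2 w)%E by rewrite lee_fin powR_ge0.
have F30 w : (0 <= F3 w)%E by rewrite lee_fin powR_ge0.
have m23 : measurable_fun [set: Om] (fun w => F2 w + F3 w)%E by exact: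
  emeasurable_funD.
have m23' : measurable_fun [set: Om] (fun w => K1%:E * (F2 w + F3 w))%E.
  exact: emeasurable_funM.
have m123 : measurable_fun [set: Om] (fun w => F1 w + K1%:E * (F2 w + F3 w))%E.
  exact: emeasurable_funD.
have K1e : (0 <= K1%:E)%E by rewrite lee_fin ltW.
have F230 w : (0 <= F2 w + F3 w)%E by exact: adde_ge0.
have F230' w : (0 <= K1%:E * (F2 w + F3 w))%E by exact: mule_ge0.
have F1230 w : (0 <= F1 w + K1%:E * (F2 w + F3 w))%E by exact: adde_ge0.
apply: (@le_trans _ _ (\int[P]_w (K1%:E * (F1 w + K1%:E * (F2 w + F3 w))))%E).
  apply: ae_ge0_le_integral.
  - exact: measurableT.
  - by move=> w _; rewrite lee_fin powR_ge0.
  - exact/measurable_EFinP/mdiff.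
  - by move=> w _; exact: mule_ge0.
  - exact: emeasurable_funM.
  - apply: filterS (filterI kD CED) => w [kw cw] _.
    rewrite (kw n n0) cw K1E.
    exact: powR_dist_split_le.
rewrite (@ge0_integralZl_EFin _ _ _ P _ measurableT _ (fun w _ => F1230 w) m123
  _ (ltW K10)).
rewrite (@ge0_integralD _ _ _ P _ measurableT _ _ (fun w _ => F10 w) mF1
  (fun w _ => F230' w) m23').
rewrite (@ge0_integralZl_EFin _ _ _ P _ measurableT _ (fun w _ => F230 w) m23 _
  (ltW K10)).
rewrite (@ge0_integralD _ _ _ P _ measurableT _ _ (fun w _ => F20 w) mF2
  (fun w _ => F30 w) mF3).
have I2 : (\int[P]_w F2 w <= (K2 * (e / 2 / K))%:E)%E.
  apply: le_trans (integral_kmean_powR_le n0 LD) _.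
  by rewrite -K2E EFinM lee_wpmul2l// lee_fin ltW.
have I3 : (\int[P]_w F3 w <= (K2 * (e / 2 / K))%:E)%E.
  apply: le_trans (integral_condexp_powR_le LD) _.
  by rewrite -K2E EFinM lee_wpmul2l// lee_fin ltW.
have eE : e = K1 * (e / 2 / K1 + K1 * (K2 * (e / 2 / K) + K2 * (e / 2 / K))).
  by rewrite /K; field; rewrite !gt_eqF.
rewrite [X in (_ <= X)%E](congr1 EFin eE) [X in (_ <= X)%E]EFinM.
rewrite [X in (_ <= _ * X)%E]EFinD [X in (_ <= _ * (_ + X))%E]EFinM.
rewrite [X in (_ <= _ * (_ + _ * X))%E]EFinD.
exact: (lee_wpmul2l K1e (leeD Ib (lee_wpmul2l K1e (leeD I2 I3)))).
Unshelve. all: by end_near. Qed.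

End mean_ergodic.

(** * Passage to the L^p norm *)

Lemma finite_norm_Lp (R : realType) (disp : measure_display)
  (Om : measurableType disp) (P : probability Om R) (p : R) (f : Om -> R) :
  1 <= p -> measurable_fun [set: Om] f -> finite_norm P p%:E f -> Lp P p f.
Proof.
move=> p1 mf ff; split => //; have p0 :
  p != 0 by rewrite gt_eqF// (lt_le_trans ltr01).
apply/integrableP; split; first by apply/measurable_EFinP; exact:
  measurable_powR_norm.
have := poweR_lty p ff; rewrite poweR_Lnorm//; apply: le_lt_trans.
rewrite le_eqVlt; apply/orP; left; apply/eqP; apply: eq_integral => w _.
by rewrite /= ger0_norm ?powR_ge0// poweR_EFin.
Qed.

Lemma cvg_poweR0 (R : realType) (x : nat -> \bar R) (q : R) : 0 < q ->
  (forall n, 0 <= x n)%E -> x n @[n --> \oo] --> 0%E ->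
  (x n `^ q)%E @[n --> \oo] --> 0%E.
Proof.
move=> q0 x0 /fine_cvgP[xfin xc].
have := cvg_powR q0 (fun n => fine_ge0 (x0 n)) xc;
  rewrite powR0 ?gt_eqF// => c0.
have : (fine (x n) `^ q)%:E @[n --> \oo] --> 0%E.
  by apply: cvg_EFin; [exact: nearW|exact: c0].
apply: cvg_trans; apply: near_eq_cvg; apply: filterS xfin => n xn.
by rewrite -[in RHS](fineK xn) poweR_EFin.
Qed.

Unset Implicit Arguments.

Theorem theorem2p3 (R : realType) (disp : measure_display)
  (Om : measurableType disp) (P : probability Om R)
  (d : nat) (hd : (0 < d)%N)
  (T Tinv : 'I_d -> Om -> Om)
  (hTK : forall i, cancel (T i) (Tinv i))
  (hTinvK : forall i, cancel (Tinv i) (T i))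
  (hT : forall i, measure_preserving P (T i))
  (hTinv : forall i, measure_preserving P (Tinv i))
  (hTcomm : forall i k, T i \o T k = T k \o T i)
  (kappa : \bar R) (hkappa : (1 <= kappa)%E)
  (psi : 'rV[R]_d -> R)
  (hpsi1 : exists theta : R -> R,
    dgood d theta /\
    forall x : 'rV[R]_d, `|psi x| <= theta (ellnorm kappa x))
  (hpsi2 : forall i : 'I_d,
    normalized_sum n (fun j : 'rV[int]_d =>
      `|psi (scaled R n j) - psi (scaled R n (j + delta_mx 0 i))|)
    @[n --> \oo] --> 0%E)
  (c : R)
  (hpsi3 : normalized_sum n (fun j : 'rV[int]_d => psi (scaled R n j))
    @[n --> \oo] --> c%:E)
  (p : R) (hp : 1 <= p)
  (f : Om -> R) (hf : measurable_fun [set: Om] f)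
  (hfp : finite_norm P p%:E f) :
  {ae P, forall w : Om,
    ergodic_sum T Tinv psi f n w @[n --> \oo] -->
    (c * condexp P (invariant_sets T) f w)%:E} /\
  Lnorm P p%:E (fun w : Om =>
      ergodic_sum T Tinv psi f n w
      - (c * condexp P (invariant_sets T) f w)%:E)%E
    @[n --> \oo] --> 0%E.
Proof.
have [theta [theta_good psi_theta]] := hpsi1.
have [C C0 HC] := dgood_sum_bound hd theta_good.
have Lf := finite_norm_Lp hp hf hfp.
have fi := Lp_integrable hp Lf.
have p0 : 0 < p by exact: lt_le_trans hp.
split.
  exact: (ergodic_ae hd hTK hTinvK hT hTinv hTcomm hkappa theta_good psi_theta
    C0 HC hpsi2 hpsi3 fi).
have mCE : measurable_fun [set: Om]
    (fun w => (c * condexp P (invariant_sets T) f w)%:E).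
  apply/measurable_EFinP; apply: measurable_funM => //.
  exact: condexp_measurable.
have mk n := measurable_ksum hT hTinv psi n hf.
have int0 n : (0 <= \int[P]_w (`|ergodic_sum T Tinv psi f n w
      - (c * condexp P (invariant_sets T) f w)%:E| `^ p))%E.
  by apply: integral_ge0 => w _; exact: poweR_ge0.
(* Unfolding [Lnorm] leaves the power 1/p of the integral; it suffices that the integral itself
   tends to 0. *)
rewrite unlock; apply: cvg_poweR0 => //; first by rewrite invr_gt0.
have := mean_ergodic hd hTK hTinvK hT hTinv hTcomm hkappa theta_good psi_theta
    C0 HC hpsi2 hpsi3 hp Lf.
(* For n >= 1 the extended-real average is finite a.s., hence equal to [kmean], and the two
   integrals coincide. *)
apply: cvg_trans; apply: near_eq_cvg; exists 1%N => // n /= n0.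
apply: ae_eq_integral => //.
- apply/measurable_EFinP; apply: measurable_powR_norm.
  by apply: measurable_funB; [exact: measurable_kmean|exact/measurable_EFinP].
- have mabse : measurable_fun [set: \bar R] (abse : \bar R -> \bar R) by [].
  apply: (measurableT_comp (measurable_poweR p)).
  exact: (measurableT_comp mabse (emeasurable_funB (mk n) mCE)).
- have ae_bounded := ae_orbit_cube_bounded hTK hTinvK hT hTinv hTcomm fi.
  apply: filterS ae_bounded => w [lam lam0 fw] _.
  have kfin := kavg_fin hd hkappa theta_good psi_theta HC n0 lam0 fw.
  by rewrite /kmean -poweR_EFin -abse_EFin EFinB fineK.
Qed.
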